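(* Let $S=\mathbb{C}[a_0,a_1,b_0,b_1,b_2,c_0,c_1,c_2,c_3]$ be the Cox ring of $\mathbb{P}^1\times\mathbb{P}^2\times\mathbb{P}^3$, let $I_6\subset S$ be the ideal defining $\phi(\overline{M}_{0,6})$, and let $J_6\subset S$ be the ideal generated by the five polynomials $$\begin{aligned} f_1&=b_1c_1c_2-b_2c_1c_2+b_2c_1c_3-b_1c_2c_3,\\ f_2&=b_0c_0c_2-b_2c_0c_2+b_2c_0c_3-b_0c_2c_3,\\ f_3&=b_0c_0c_1-b_1c_0c_1+b_1c_0c_3-b_0c_1c_3,\\ f_4&=a_0c_0c_1-a_1c_0c_1+a_1c_0c_2-a_0c_1c_2,\\ f_5&=a_0b_0b_1-a_1b_0b_1+a_1b_0b_2-a_0b_1b_2.\end{aligned}$$ Then the ideal $\tilde I_6$ generated by all polynomials of multidegree $(d,d,d)$ (over all $d$) in $I_6$ is generated by the polynomials of multidegree $(2,2,2)$ in $J_6$. Equivalently, the homogeneous ideal of the image of the embedding of $\overline{M}_{0,6}$ in $\mathbb{P}^{23}$ defined by the $\kappa$ class is generated by the polynomials of multidegree $(2,2,2)$ in $J_6$ (that is, by their preimages as quadrics in the coordinate ring of $\mathbb{P}^{23}$) together with the Segre relations.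
   Context: $\overline{M}_{0,6}$ is the moduli space (over $\mathbb{C}$) of stable $6$-pointed rational curves. The closed embedding $\phi:\overline{M}_{0,6}\hookrightarrow\mathbb{P}^1_{[a_0:a_1]}\times\mathbb{P}^2_{[b_0:b_1:b_2]}\times\mathbb{P}^3_{[c_0:c_1:c_2:c_3]}$ is obtained by successively applying the closed embeddings $(\pi_m,\psi_m):\overline{M}_{0,m}\hookrightarrow\overline{M}_{0,m-1}\times\mathbb{P}^{m-3}$, where $\pi_m$ forgets the last point and $\psi_m$ is the Kapranov map of the cotangent line bundle at the last point. In coordinates, on the locus of distinct $p_1,\ldots,p_6\in\mathbb{P}^1$ (in an affine coordinate), $a_j=\frac{p_1-p_{j+2}}{p_4-p_{j+2}}$, $b_j=\frac{p_1-p_{j+2}}{p_5-p_{j+2}}$, $c_j=\frac{p_1-p_{j+2}}{p_6-p_{j+2}}$. The ideal $I_6$ is the unique $B$-saturated multigraded ideal defining $\phi(\overline{M}_{0,6})$ scheme-theoretically, where $B=\langle a_0,a_1\rangle\cap\langle b_0,b_1,b_2\rangle\cap\langle c_0,c_1,c_2,c_3\rangle$. Multidegree is with respect to the $\mathbb{Z}^3$-grading by the degrees in the $a$'s, $b$'s, $c$'s. The class $\kappa=K_{\overline{M}_{0,6}}+\sum\delta_I$ (canonical class plus all boundary divisors) is very ample. By Keel–Tevelev, its complete linear system gives the embedding of $\overline{M}_{0,6}$ into $\mathbb{P}^{23}$ equal to $\phi$ followed by the Segre embedding $\mathbb{P}^1\times\mathbb{P}^2\times\mathbb{P}^3\hookrightarrow\mathbb{P}^{23}$.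 The Segre embedding corresponds to the ring map $\mathbb{C}[t_{ijk}]\to S$, $t_{ijk}\mapsto a_ib_jc_k$, whose kernel is generated by the (quadratic) Segre relations. Preimages are taken under this ring map. *)

(* Defs.v *)
From mathcomp Require Import all_boot all_order all_algebra.
From mathcomp Require Import reals complex.
From mathcomp Require Import mpoly.

Set Implicit Arguments.
Unset Strict Implicit.
Unset Printing Implicit Defensive.

Import Order.TTheory GRing.Theory Num.Theory.
Local Open Scope ring_scope.

Section Ideals.
Variable T : comNzRingType.

Definition is_ideal (I : T -> Prop) : Prop :=
  [/\ I 0, forall p q, I p -> I q -> I (p + q) & forall r p, I p -> I (r * p)].

Definition ideal_gen (G : T -> Prop) : T -> Prop := fun p =>
  exists (n : nat) (r g : 'I_n -> T),
    (forall i, G (g i)) /\ p = \sum_(i < n) r i * g i.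

End Ideals.

(* Points of P^1 x P^2 x P^3 are given by homogeneous coordinate vectors, and a
   subset of that product by a predicate on triples of such vectors. *)

Section StableCurves.
Variable K : fieldType.

(* Points of P^1 are given by homogeneous coordinates; in an affine coordinate,
   i.e. for x = (s, 1) and y = (t, 1), br x y is s - t. *)
Definition br (x y : 'rV[K]_2) : K := x 0 0 * y 0 1 - x 0 1 * y 0 0.

(* The special points of the component v: the nodes joining v to its
   neighbours (inl) and the marked points lying on v (inr). *)
Definition special (V : finType) (n : nat) (node : rel V) (mark : 'I_n -> V)
    (v : V) (s : V + 'I_n) : bool :=
  match s with inl w => node v w | inr i => mark i == v end.

(* A stable n-pointed rational curve: a tree of copies of P^1, where
   pt v (inl w) is the point of v glued to the point pt w (inl v) of w, and
   pt (mark i) (inr i) is the i-th marked point.  The values of pt v outside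
   of the special points of v are irrelevant. *)
Record stable_curve (n : nat) := StableCurve {
  component : finType;
  node : rel component;
  mark : 'I_n -> component;
  pt : component -> component + 'I_n -> 'rV[K]_2;
  node_sym : ssrbool.symmetric node;
  node_irr : irreflexive node;
  node_tree : forall v w, exists! p : seq component,
    [&& path node v p, uniq (v :: p) & last v p == w];
  pt_distinct : forall v s t, special node mark v s -> special node mark v t ->
    s != t -> br (pt v s) (pt v t) != 0;
  stability : forall v, (2 < #|[pred s | special node mark v s]|)%N
}.

Variable G : stable_curve 6.

(* The special point of v at which the i-th marked point is seen from v. *)
Definition toward (v : component G) (i : 'I_6) (s : component G + 'I_6) : Prop :=
  match s with
  | inr j => j = i /\ mark G i = v
  | inl w => exists p, [/\ path (@node _ G) v (w :: p), uniq (v :: w :: p)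
                        & last w p = mark G i]
  end.

(* x i is the image of the i-th marked point under the contraction of G
   onto its component v. *)
Definition images (v : component G) (x : 'I_6 -> 'rV[K]_2) : Prop :=
  forall i, exists2 s, toward v i s & x i = pt v s.

(* Marked points are numbered from 0.  Forget all marked points but the first
   m.+1 of them and stabilize (this is pi_(m+2) o ... o pi_6).  The components
   that are not contracted are those on which the first m.+1 marked points have
   at least three distinct images; the marked point number m lies on such a
   component iff its image differs from those of all preceding points. *)
Definition last_on (m : nat) (v : component G) (x : 'I_6 -> 'rV[K]_2) : Prop :=
  [/\ images v x,
      exists i j k : 'I_6,
        [/\ (i <= m)%N, (j <= m)%N & (k <= m)%N] /\
        [/\ br (x i) (x j) != 0, br (x i) (x k) != 0 & br (x j) (x k) != 0]
    & forall i : 'I_6, (i < m)%N -> br (x (inord m)) (x i) != 0].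

(* The Kapranov map psi_(k+2) : M_(0,k+2) -> P^(k-1), composed with the
   forgetful maps.  On the component carrying the last point p_m (m = k + 2),
   its j-th coordinate is (p_1 - p_(j+2)) / (p_m - p_(j+2)).  Up to a factor
   independent of j this is the value at p_m of the section of the dualizing
   sheaf with simple poles at p_1 and p_(j+2) and residues 1 and -1; these
   values are a basis of the sections of the cotangent line bundle at p_m.
   On a smooth curve one recovers the usual coordinates. *)
Definition kapranov (k : nat) (z : 'rV[K]_k) : Prop :=
  exists (v : component G) (x : 'I_6 -> 'rV[K]_2) (l : K),
    [/\ last_on k.+1 v x, l != 0
      & forall j : 'I_k, z 0 j =
          l * (br (x ord0) (x (inord j.+1)) /
               br (x (inord k.+1)) (x (inord j.+1)))].

End StableCurves.

(* The closed points of the image of M_(0,6)-bar under phi. *)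
Definition phi_image (K : fieldType)
    (a : 'rV[K]_2) (b : 'rV[K]_3) (c : 'rV[K]_4) : Prop :=
  exists G : stable_curve K 6, [/\ kapranov G a, kapranov G b & kapranov G c].

Section CoxRing.
Variable K : fieldType.

Local Notation S := {mpoly K[2 + (3 + 4)]}.

Definition avar : 'rV[S]_2 := \row_i 'X_(lshift (3 + 4) i).
Definition bvar : 'rV[S]_3 := \row_j 'X_(rshift 2 (lshift 4 j)).
Definition cvar : 'rV[S]_4 := \row_k 'X_(rshift 2 (rshift 3 k)).

Definition coords (a : 'rV[K]_2) (b : 'rV[K]_3) (c : 'rV[K]_4) :
  'I_(2 + (3 + 4)) -> K := row_mx a (row_mx b c) 0.

Definition multihomog (da db dc : nat) (p : S) : Prop :=
  forall m, m \in msupp p ->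
    [/\ (\sum_(i < 2) m (lshift (3 + 4) i) = da)%N,
        (\sum_(j < 3) m (rshift 2 (lshift 4 j)) = db)%N
      & (\sum_(k < 4) m (rshift 2 (rshift 3 k)) = dc)%N].

Definition multigraded (I : S -> Prop) : Prop :=
  forall p, I p ->
    ideal_gen (fun q => I q /\ exists da db dc, multihomog da db dc q) p.

(* The irrelevant ideal B. *)
Definition irrelevant (p : S) : Prop :=
  [/\ ideal_gen (fun q => exists i, q = avar 0 i) p,
      ideal_gen (fun q => exists j, q = bvar 0 j) p
    & ideal_gen (fun q => exists k, q = cvar 0 k) p].

(* (I : B^oo) is contained in I, for an ideal I. *)
Definition saturated (I : S -> Prop) : Prop :=
  forall p,
    (exists N : nat, forall g : 'I_N -> S,
       (forall i, irrelevant (g i)) -> I ((\prod_(i < N) g i) * p)) ->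
    I p.

(* The closed subscheme defined by I is X with its reduced structure: on each
   chart a_i b_j c_k != 0, the degree 0 part of the localization of I is the
   ideal of X.  A function on that chart is p / (a_i^da b_j^db c_k^dc) with p
   multihomogeneous; it belongs to the localization of I iff p multiplied by
   some power of a_i b_j c_k belongs to I. *)
Definition defines_scheme (I : S -> Prop)
    (X : 'rV[K]_2 -> 'rV[K]_3 -> 'rV[K]_4 -> Prop) : Prop :=
  forall (i : 'I_2) (j : 'I_3) (k : 'I_4) (da db dc : nat) (p : S),
    multihomog da db dc p ->
    (forall a b c, X a b c -> a 0 i * b 0 j * c 0 k != 0 ->
       p.@[coords a b c] = 0) <->
    (exists N : nat, I ((avar 0 i * bvar 0 j * cvar 0 k) ^+ N * p)).

(* These conditions determine I uniquely. *)
Definition is_I6 (I : S -> Prop) : Prop :=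
  [/\ is_ideal I, multigraded I, saturated I & defines_scheme I (@phi_image K)].

Local Notation a i := (avar 0 (inord i)).
Local Notation b j := (bvar 0 (inord j)).
Local Notation c k := (cvar 0 (inord k)).

Definition f1 : S := b 1 * c 1 * c 2 - b 2 * c 1 * c 2
                   + b 2 * c 1 * c 3 - b 1 * c 2 * c 3.
Definition f2 : S := b 0 * c 0 * c 2 - b 2 * c 0 * c 2
                   + b 2 * c 0 * c 3 - b 0 * c 2 * c 3.
Definition f3 : S := b 0 * c 0 * c 1 - b 1 * c 0 * c 1
                   + b 1 * c 0 * c 3 - b 0 * c 1 * c 3.
Definition f4 : S := a 0 * c 0 * c 1 - a 1 * c 0 * c 1
                   + a 1 * c 0 * c 2 - a 0 * c 1 * c 2.
Definition f5 : S := a 0 * b 0 * b 1 - a 1 * b 0 * b 1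
                   + a 1 * b 0 * b 2 - a 0 * b 1 * b 2.

Definition J6 : S -> Prop :=
  ideal_gen (fun p => p \in [:: f1; f2; f3; f4; f5]).

Definition J6_222 (p : S) : Prop := J6 p /\ multihomog 2 2 2 p.

(* The ideal generated by the elements of I of multidegree (d,d,d), d >= 0. *)
Definition diagonal_ideal (I : S -> Prop) : S -> Prop :=
  ideal_gen (fun p => I p /\ exists d, multihomog d d d p).

End CoxRing.

(* The entry of index mxvec_index i (mxvec_index j k) is a_i b_j c_k. *)
Definition segre (T : comNzRingType)
    (a : 'rV[T]_2) (b : 'rV[T]_3) (c : 'rV[T]_4) : 'rV[T]_(2 * (3 * 4)) :=
  mxvec (a^T *m mxvec (b^T *m c)).

Section KappaEmbedding.
Variable K : fieldType.

Local Notation S := {mpoly K[2 + (3 + 4)]}.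
Local Notation P := {mpoly K[2 * (3 * 4)]}.

Definition tvar (i : 'I_2) (j : 'I_3) (k : 'I_4) : P :=
  'X_(mxvec_index i (mxvec_index j k)).

(* The ring map t_ijk |-> a_i b_j c_k. *)
Definition segre_map (q : P) : S :=
  q \mPo [tuple segre (avar K) (bvar K) (cvar K) 0 l | l < 2 * (3 * 4)].

Definition segre_relation (q : P) : Prop :=
  exists (i i' : 'I_2) (j j' : 'I_3) (k k' : 'I_4),
    [\/ q = tvar i j k * tvar i' j' k' - tvar i' j k * tvar i j' k',
        q = tvar i j k * tvar i' j' k' - tvar i j' k * tvar i' j k'
      | q = tvar i j k * tvar i' j' k' - tvar i j k' * tvar i' j' k].

(* The image of the embedding of M_(0,6)-bar in P^23 by the complete linear
   system of kappa = K + sum of the boundary divisors; by Keel-Tevelev it is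
   the Segre embedding composed with phi. *)
Definition kappa_image (y : 'rV[K]_(2 * (3 * 4))) : Prop :=
  exists a b c, phi_image a b c /\ y = segre a b c.

Definition homog_ideal (Y : 'rV[K]_(2 * (3 * 4)) -> Prop) : P -> Prop :=
  ideal_gen (fun q : P =>
    (exists d : nat, q \is d.-homog) /\ forall y, Y y -> q.@[y 0] = 0).

(* The quadrics whose image is of multidegree (2,2,2) and in J_6. *)
Definition J6_quadric (q : P) : Prop :=
  q \is 2.-homog /\ J6_222 (segre_map q).

End KappaEmbedding.

(* Main.v *)
Require Import Defs.
From mathcomp Require Import all_boot all_order all_algebra.
From mathcomp Require Import reals complex.
From mathcomp Require Import mpoly.
From mathcomp Require Import zify ring.

Set Implicit Arguments.
Unset Strict Implicit.
Unset Printing Implicit Defensive.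

Import Order.TTheory GRing.Theory Num.Theory.
Local Open Scope ring_scope.

(** Put p_1 at infinity and let y_0, ..., y_4 be the affine coordinates of
    p_2, ..., p_6.  Up to scaling, the point of P^1 x P^2 x P^3 attached to six
    distinct points is
      a_i = 1 / (y_2 - y_i),  b_j = 1 / (y_3 - y_j),  c_k = 1 / (y_4 - y_k).
    A form of multidegree (d,d,d) that vanishes on the image is thus a linear
    relation between products of these fractions, and everything reduces to
    showing that each such relation is generated by J_6 in multidegree (2,2,2).

    Such relations are detected by poles.  Let k be the largest index for which
    c_k divides a monomial, with exponent e.  The monomial has a pole of order e
    along y_4 = y_k, and its leading coefficient there is obtained by putting
    y_4 = y_k in the other factors: for k = 3 the remaining c_j turn into b_j,
    for k = 2 they turn into a_j, and for k = 1 they turn into powers of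
    1 / (y_1 - y_0), which may be normalized to 1 ([collapse]).  The same is
    done for b with the variable y_3, and what is left is a monomial in a_0 and
    a_1.  The resulting data, compared lexicographically, are the [level] of a
    monomial.  Two facts about the level prove the theorem.
    - In a linear relation, the coefficients of the monomials of highest level
      add up to 0 ([top_coef_sum0]): take leading coefficients at the poles, in
      the variables y_4, y_3, y_2 in turn ([pole]).
    - Two monomials of the same level are congruent modulo J_6 in multidegree
      (2,2,2) and monomials of lower level ([congr_level]).  Indeed, up to lower
      level, f_1, f_2, f_3 exchange b_i c_j c_3 and b_j c_i c_3, f_4 exchanges
      a_0 c_1 c_2 and a_1 c_0 c_2, and f_5 exchanges a_0 b_1 b_2 and
      a_1 b_0 b_2; these moves connect all monomials of a given level.  As
      all f_i have multidegree at most (2,2,2), every move happens inside the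
      ideal generated by the part of J_6 of multidegree (2,2,2).
    So the top part of a relation can be removed, and induction on the level
    finishes the proof ([below_Z], [vanishing_generated]).

    Conversely the f_i must vanish on all of the image, boundary included.  All
    five are the same expression [generator_form], which involves two of the three
    Kapranov maps and hence two components v, w of the stable curve.  If v = w
    it vanishes by a direct computation; if v and w are distinct, every marked
    point is seen from v in the direction of w or from w in the direction of v
    ([images_apart]), and these coincidences force the expression to vanish.
    Saturation then passes from vanishing on the image to membership in I_6
    ([saturated_charts]).

    For the ideal in P^23, lift along the Segre map: its kernel is generated by
    the Segre relations ([segre_kernel]), because they allow one to permute each
    of the three index sequences of a monomial independently. *)

(** * Monomials of the Cox ring *)
Section Monomials.
Variable K : fieldType.
Local Notation S := {mpoly K[2 + (3 + 4)]}.
Local Notation a i := (avar K 0 (inord i)).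
Local Notation b j := (bvar K 0 (inord j)).
Local Notation c k := (cvar K 0 (inord k)).

(** The exponents of the nine variables as separate numbers, so that
    statements about them are linear arithmetic. *)
Record expo := Expo { ea0 : nat; ea1 : nat; eb0 : nat; eb1 : nat; eb2 : nat;
                      ec0 : nat; ec1 : nat; ec2 : nat; ec3 : nat }.

Definition mon (e : expo) : S :=
  a 0 ^+ ea0 e * a 1 ^+ ea1 e
  * (b 0 ^+ eb0 e * b 1 ^+ eb1 e * b 2 ^+ eb2 e)
  * (c 0 ^+ ec0 e * c 1 ^+ ec1 e * c 2 ^+ ec2 e * c 3 ^+ ec3 e).

Definition aidx (i : nat) : 'I_(2 + (3 + 4)) := lshift (3 + 4) (inord i).
Definition bidx (j : nat) : 'I_(2 + (3 + 4)) := rshift 2 (lshift 4 (inord j)).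
Definition cidx (k : nat) : 'I_(2 + (3 + 4)) := rshift 2 (rshift 3 (inord k)).

Definition expo_of (m : 'X_{1..2 + (3 + 4)}) : expo :=
  Expo (m (aidx 0)) (m (aidx 1)) (m (bidx 0)) (m (bidx 1)) (m (bidx 2))
       (m (cidx 0)) (m (cidx 1)) (m (cidx 2)) (m (cidx 3)).

Definition mdegs (da db dc : nat) (e : expo) : Prop :=
  [/\ ea0 e + ea1 e = da, eb0 e + eb1 e + eb2 e = db
    & ec0 e + ec1 e + ec2 e + ec3 e = dc]%N.

Lemma inord_big n (T : Type) (idx : T) (op : Monoid.law idx) (F : 'I_n.+1 -> T) :
  \big[op/idx]_(i < n.+1) F i = \big[op/idx]_(0 <= i < n.+1) F (inord i).
Proof. by rewrite big_mkord; apply: eq_bigr => i _; rewrite inord_val. Qed.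

Lemma mon_expo_of m : mon (expo_of m) = 'X_[m].
Proof.
rewrite [RHS]mpolyXE_id !big_split_ord /= !inord_big.
rewrite !big_nat_recl // !big_geq // /mon /= !mxE !mulr1 /aidx /bidx /cidx.
by rewrite -!mulrA.
Qed.

Lemma multihomogE da db dc (p : S) :
  multihomog da db dc p <-> forall m, m \in msupp p -> mdegs da db dc (expo_of m).
Proof.
split=> hp m /hp; rewrite /mdegs /expo_of /= !inord_big !big_nat_recl // !big_geq //=;
  rewrite /aidx /bidx /cidx /=; case=> h1 h2 h3; split; lia.
Qed.

Lemma expo_of_onto e : exists m, expo_of m = e.
Proof.
case: e => x0 x1 y0 y1 y2 z0 z1 z2 z3.
exists [multinom [tuple x0; x1; y0; y1; y2; z0; z1; z2; z3]].
by rewrite /expo_of; congr Expo; rewrite /fun_of_multinom /= (tnth_nth 0%N) /= !inordK.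
Qed.

Lemma expo_of_inj : injective expo_of.
Proof.
move=> m m' [h1 h2 h3 h4 h5 h6 h7 h8 h9]; apply/mnmP => i.
case: (split_ordP i) => [j -> | j ->].
  by rewrite -[j]inord_val; case: j => [[|[|]]].
case: (split_ordP j) => [k -> | k ->].
  by rewrite -[k]inord_val; case: k => [[|[|[|]]]].
by rewrite -[k]inord_val; case: k => [[|[|[|[|]]]]].
Qed.

Lemma multihomog_mon da db dc e : mdegs da db dc e -> multihomog da db dc (mon e).
Proof.
have [m <-] := expo_of_onto e; rewrite mon_expo_of => h; apply/multihomogE => m'.
by rewrite msuppX inE => /eqP->.
Qed.

Lemma multihomog0 da db dc : multihomog da db dc (0 : S).
Proof. by move=> m; rewrite msupp0. Qed.

Lemma multihomogD da db dc (p q : S) :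
  multihomog da db dc p -> multihomog da db dc q -> multihomog da db dc (p + q).
Proof. by move=> hp hq m /msuppD_le; rewrite mem_cat => /orP[/hp|/hq]. Qed.

Lemma multihomogZ da db dc x (p : S) :
  multihomog da db dc p -> multihomog da db dc (x *: p).
Proof. by move=> hp m /msuppZ_le /hp. Qed.

End Monomials.

Arguments expo_of : simpl never.

(** * The level of a monomial *)
Section Reduction.

(** Exceeds every exponent that occurs in multidegree (d,d,d), so that
    lexicographic comparison of leading data becomes comparison of numbers. *)
Definition radix (d : nat) := (3 * d + 4)%N.

(** Position k and order e of the highest pole in y_4, as k * radix + e. *)
Definition lead_c d e :=
  (if 0 < ec3 e then 3 * radix d + ec3 e
   else if 0 < ec2 e then 2 * radix d + ec2 e
   else if 0 < ec1 e then radix d + ec1 e else ec0 e)%N.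

Record expo5 := Expo5 { da0 : nat; da1 : nat; db0 : nat; db1 : nat; db2 : nat }.

(** The leading coefficient at that pole, as a monomial in the a_i and b_j; the
    factors 1 / (y_1 - y_0) are dropped since y_1 - y_0 is normalized to 1. *)
Definition collapse e : expo5 :=
  if (0 < ec3 e)%N then
    Expo5 (ea0 e) (ea1 e) (eb0 e + ec0 e) (eb1 e + ec1 e) (eb2 e + ec2 e)
  else if (0 < ec2 e)%N then
    Expo5 (ea0 e + ec0 e) (ea1 e + ec1 e) (eb0 e) (eb1 e) (eb2 e)
  else Expo5 (ea0 e) (ea1 e) (eb0 e) (eb1 e) (eb2 e).

(** Position and order of the highest pole in y_3. *)
Definition lead_b d g :=
  (if 0 < db2 g then 2 * radix d + db2 g
   else if 0 < db1 g then radix d + db1 g else db0 g)%N.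

(** The exponent of a_1 once y_3 has been moved to its pole: at y_3 = y_2 each
    b_1 turns into a_1. *)
Definition lead_a1 g := (if 0 < db2 g then da1 g + db1 g else da1 g)%N.

Definition level d e :=
  ((lead_c d e * (4 * radix d) + lead_b d (collapse e)) * radix d
   + lead_a1 (collapse e))%N.

Lemma lex_lt W u v x y : (u < W -> x < y -> x * W + u < y * W + v)%N.
Proof. by move=> hu hxy; nia. Qed.

Lemma lead_bounds d e : mdegs d d d e ->
  (lead_b d (collapse e) < 4 * radix d)%N /\ (lead_a1 (collapse e) < radix d)%N.
Proof.
case=> hA hB hC; rewrite /lead_b /lead_a1 /collapse /radix.
by do !(case: ifP => /= ?); split; lia.
Qed.

Lemma level_lt_c d e e' : mdegs d d d e' -> (lead_c d e' < lead_c d e)%N ->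
  (level d e' < level d e)%N.
Proof.
move=> /lead_bounds[h2 h3] h1; rewrite /level; apply: lex_lt => //.
exact: lex_lt.
Qed.

Lemma level_lt_b d e e' : mdegs d d d e' -> lead_c d e' = lead_c d e ->
  (lead_b d (collapse e') < lead_b d (collapse e))%N -> (level d e' < level d e)%N.
Proof.
move=> /lead_bounds[h2 h3] h1 h; rewrite /level h1; apply: lex_lt => //.
by rewrite ltn_add2l.
Qed.

Lemma lex_inj W u v x y : (u < W -> v < W -> x * W + u = y * W + v ->
  x = y /\ u = v)%N.
Proof. by move=> hu hv h; have hxy : x = y; [nia | split; [|lia]]. Qed.

Lemma lex_le W u v x y : (v < W -> x * W + u <= y * W + v -> x <= y)%N.
Proof. by move=> hv h; nia. Qed.

Lemma level_inj d e e' : mdegs d d d e -> mdegs d d d e' ->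
  level d e = level d e' ->
  [/\ lead_c d e = lead_c d e', lead_b d (collapse e) = lead_b d (collapse e')
    & lead_a1 (collapse e) = lead_a1 (collapse e')].
Proof.
move=> /lead_bounds[h2 h3] /lead_bounds[h2' h3'] /lex_inj[]// /lex_inj[]//.
Qed.

Lemma level_le d e e' : mdegs d d d e -> mdegs d d d e' ->
  (level d e <= level d e')%N ->
  (lead_c d e <= lead_c d e')%N /\ (lead_c d e = lead_c d e' ->
  (lead_b d (collapse e) <= lead_b d (collapse e'))%N /\
  (lead_b d (collapse e) = lead_b d (collapse e') ->
  (lead_a1 (collapse e) <= lead_a1 (collapse e'))%N)).
Proof.
move=> /lead_bounds[h2 h3] /lead_bounds[h2' h3'] h.
have h1 := lex_le h3' h; split; first exact: lex_le h1.
move=> e1; move: h h1; rewrite /level e1 leq_add2l => h h1; split=> // e2.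
by move: h; rewrite e2 leq_add2l.
Qed.

Lemma split2 x y s t : (x + y = s + t)%N -> exists x1 y1 x2 y2,
  [/\ x = x1 + x2, y = y1 + y2, x1 + y1 = s & x2 + y2 = t]%N.
Proof.
move=> h; exists (minn x s), (s - x)%N, (x - s)%N, (y - (s - x))%N; split; lia.
Qed.

Lemma split3 x y z s t : (x + y + z = s + t)%N -> exists x1 y1 z1 x2 y2 z2,
  [/\ [/\ x = x1 + x2, y = y1 + y2 & z = z1 + z2], x1 + y1 + z1 = s
    & x2 + y2 + z2 = t]%N.
Proof.
case/split2=> v [z1 [v2 [z2 [e0 -> hs ht]]]].
have [x1 [y1 [x2 [y2 [-> -> h1 h2]]]]] := split2 e0.
exists x1, y1, z1, x2, y2, z2; split; [by split | lia | lia].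
Qed.

Lemma split4 x y z w s t : (x + y + z + w = s + t)%N ->
  exists x1 y1 z1 w1 x2 y2 z2 w2,
  [/\ [/\ x = x1 + x2, y = y1 + y2, z = z1 + z2 & w = w1 + w2],
   x1 + y1 + z1 + w1 = s & x2 + y2 + z2 + w2 = t]%N.
Proof.
case/split3=> v [z1 [w1 [v2 [z2 [w2 [[e0 -> ->] hs ht]]]]]].
have [x1 [y1 [x2 [y2 [-> -> h1 h2]]]]] := split2 e0.
exists x1, y1, z1, w1, x2, y2, z2, w2; split; [by split | lia | lia].
Qed.

Definition expo_add e e' := Expo (ea0 e + ea0 e') (ea1 e + ea1 e')
  (eb0 e + eb0 e') (eb1 e + eb1 e') (eb2 e + eb2 e')
  (ec0 e + ec0 e') (ec1 e + ec1 e') (ec2 e + ec2 e') (ec3 e + ec3 e').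

Lemma mdegs_split da db dc da' db' dc' e :
  mdegs (da + da') (db + db') (dc + dc') e ->
  exists e1 e2, [/\ e = expo_add e1 e2, mdegs da db dc e1 & mdegs da' db' dc' e2].
Proof.
case: e => x0 x1 y0 y1 y2 z0 z1 z2 z3; rewrite /mdegs /= => -[].
case/split2=> x01 [x11 [x02 [x12 [-> -> hx1 hx2]]]].
case/split3=> y01 [y11 [y21 [y02 [y12 [y22 [[-> -> ->] hy1 hy2]]]]]].
case/split4=> z01 [z11 [z21 [z31 [z02 [z12 [z22 [z32 [[-> -> -> ->] hz1 hz2]]]]]]]].
by exists (Expo x01 x11 y01 y11 y21 z01 z11 z21 z31),
  (Expo x02 x12 y02 y12 y22 z02 z12 z22 z32).
Qed.

Variable K : fieldType.
Local Notation S := {mpoly K[2 + (3 + 4)]}.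

Lemma mon_add e e' : mon K (expo_add e e') = mon K e * mon K e'.
Proof. by rewrite /mon /= !exprD; ring. Qed.

End Reduction.

(** * Straightening *)
Section Straightening.
Variable K : fieldType.
Local Notation S := {mpoly K[2 + (3 + 4)]}.
Local Notation mon := (@mon K).

(* Z is any space of polynomials that contains the products of a monomial of
   multidegree (k,k,k) with an element of J_6 of multidegree (2,2,2).  Keeping it
   abstract serves both the ideal in the Cox ring and the one in P^23. *)
Variable Z : S -> Prop.
Hypothesis Z0 : Z 0.
Hypothesis ZD : forall p q, Z p -> Z q -> Z (p + q).
Hypothesis ZZ : forall x p, Z p -> Z (x *: p).
Hypothesis Zgen : forall k e g, mdegs k k k e -> J6_222 g -> Z (mon e * g).
Variable d : nat.

Definition below (L : nat) (p : S) : Prop := forall m, m \in msupp p ->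
  mdegs d d d (expo_of m) /\ (level d (expo_of m) < L)%N.

Definition low (L : nat) (p : S) : Prop :=
  exists j h, [/\ Z j, below L h & p = j + h].

Lemma below0 L : below L 0. Proof. by move=> m; rewrite msupp0. Qed.

Lemma belowD L p q : below L p -> below L q -> below L (p + q).
Proof. by move=> hp hq m /msuppD_le; rewrite mem_cat => /orP[/hp|/hq]. Qed.

Lemma belowZ L x p : below L p -> below L (x *: p).
Proof. by move=> hp m /msuppZ_le /hp. Qed.

Lemma below_mon L e : mdegs d d d e -> (level d e < L)%N -> below L (mon e).
Proof.
have [m <-] := expo_of_onto e; rewrite mon_expo_of => he hL m'.
by rewrite msuppX inE => /eqP->.
Qed.

Lemma low_below L p : below L p -> low L p.
Proof. by move=> h; exists 0, p; split; rewrite ?add0r. Qed.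

Lemma low_of_Z L p : Z p -> low L p.
Proof. by move=> h; exists p, 0; split; rewrite ?addr0 //; apply: below0. Qed.

Lemma lowD L p q : low L p -> low L q -> low L (p + q).
Proof.
move=> [j [h [hj hh ->]]] [j' [h' [hj' hh' ->]]].
exists (j + j'), (h + h'); split; [exact: ZD | exact: belowD | by rewrite addrACA].
Qed.

Lemma lowZ L x p : low L p -> low L (x *: p).
Proof.
move=> [j [h [hj hh ->]]]; exists (x *: j), (x *: h).
by split; [exact: ZZ | exact: belowZ | rewrite scalerDr].
Qed.

Lemma lowN L p : low L p -> low L (- p).
Proof. by rewrite -scaleN1r; apply: lowZ. Qed.

Definition congr_mon L e e' := low L (mon e - mon e').

Lemma congr_refl L e : congr_mon L e e.
Proof. by rewrite /congr_mon subrr; apply: low_of_Z. Qed.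

Lemma congr_sym L e e' : congr_mon L e e' -> congr_mon L e' e.
Proof. by rewrite /congr_mon -[mon e' - _]opprB; apply: lowN. Qed.

Lemma congr_trans L e' e e'' :
  congr_mon L e e' -> congr_mon L e' e'' -> congr_mon L e e''.
Proof.
by move=> h /(lowD h); rewrite /congr_mon addrA subrK.
Qed.

Lemma mdegs_add da db dc da' db' dc' e e' : mdegs da db dc e ->
  mdegs da' db' dc' e' -> mdegs (da + da') (db + db') (dc + dc') (expo_add e e').
Proof.
rewrite /mdegs /= => -[<- <- <-] [<- <- <-].
by split; lia.
Qed.

(** One move: the two leading terms u, v of a generator f may be exchanged, in
    any multiple by n, when the other two terms w, w' have lower level.  Since
    the multidegree of f is at most (2,2,2), n splits into a factor that brings
    f to multidegree (2,2,2) and a factor of multidegree (d-2,d-2,d-2). *)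
Lemma congr_step f u v w w' da db dc n L :
  f \in [:: f1 K; f2 K; f3 K; f4 K; f5 K] ->
  f = mon u - mon v + (mon w - mon w') ->
  mdegs da db dc u -> mdegs da db dc v -> mdegs da db dc w -> mdegs da db dc w' ->
  (da <= 2)%N -> (db <= 2)%N -> (dc <= 2)%N -> (2 <= d)%N ->
  mdegs (d - da) (d - db) (d - dc) n ->
  (level d (expo_add n w) < L)%N -> (level d (expo_add n w') < L)%N ->
  congr_mon L (expo_add n u) (expo_add n v).
Proof.
move=> hf fE hu hv hw hw' ha hb hc hd hn lw lw'.
have hadd x : mdegs da db dc x -> mdegs d d d (expo_add n x).
  by move=> hx; have := mdegs_add hn hx; rewrite !subnK //; lia.
rewrite /congr_mon !mon_add.
have -> : mon n * mon u - mon n * mon v =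
    mon n * f + (mon (expo_add n w') - mon (expo_add n w)).
  by rewrite fE !mon_add; ring.
apply: lowD; last first.
  apply: low_below; apply: belowD; first by apply: below_mon => //; apply: hadd.
  by rewrite -scaleN1r; apply/belowZ/below_mon => //; apply: hadd.
apply: low_of_Z.
have [n1 [n2 [-> hn1 hn2]]] : exists e1 e2, [/\ n = expo_add e1 e2,
    mdegs (2 - da) (2 - db) (2 - dc) e1 & mdegs (d - 2) (d - 2) (d - 2) e2].
  apply: mdegs_split; move: hn.
  by congr mdegs; lia.
rewrite mon_add mulrAC mulrC; apply: Zgen hn2 _; split.
  exists 1%N, (fun _ => mon n1), (fun _ => f); split=> //.
  by rewrite big_ord1.
have hadd2 x : mdegs da db dc x -> mdegs 2 2 2 (expo_add n1 x).
  by move=> hx; have := mdegs_add hn1 hx; rewrite !subnK.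
rewrite fE mulrDr !mulrBr -!mon_add.
by do !apply: multihomogD; rewrite -?scaleN1r; do ?apply: multihomogZ;
  apply: multihomog_mon; apply: hadd2.
Qed.

Section Moves.
Variable L : nat.

Section PoleAtLast.
Variable e3 : nat.
Hypothesis hL : forall x, mdegs d d d x ->
  (lead_c d x < 3 * radix d + e3.+1)%N -> (level d x < L)%N.

Let lower x : mdegs d d d x -> ec3 x = e3 -> (level d x < L)%N.
Proof.
move=> hx h3; apply: hL => //; case: hx => _ _; rewrite h3 => hc.
by rewrite /lead_c /radix; do !case: ifP => ?; lia.
Qed.

(** The other terms of f_3, like those of f_1 and f_2, contain c_3 to a lower
    power. *)
Lemma congr_f3 A0 A1 B0 B1 B2 C0 C1 C2 :
  mdegs d d d (Expo A0 A1 B0 B1.+1 B2 C0.+1 C1 C2 e3.+1) ->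
  congr_mon L (Expo A0 A1 B0 B1.+1 B2 C0.+1 C1 C2 e3.+1)
              (Expo A0 A1 B0.+1 B1 B2 C0 C1.+1 C2 e3.+1).
Proof.
move=> h; have := @congr_step (f3 K) (Expo 0 0 0 1 0 1 0 0 1) (Expo 0 0 1 0 0 0 1 0 1)
  (Expo 0 0 1 0 0 1 1 0 0) (Expo 0 0 0 1 0 1 1 0 0) 0 1 2
  (Expo A0 A1 B0 B1 B2 C0 C1 C2 e3) L.
rewrite /expo_add /= !(addn0, addn1); apply=> //; move: h; rewrite /mdegs /= => -[*].
- by rewrite !inE eqxx ?orbT.
- by rewrite /f3 /mon /=; ring.
- lia.
- split; lia.
- by apply: lower => //; split=> /=; lia.
- by apply: lower => //; split=> /=; lia.
Qed.

Lemma congr_f2 A0 A1 B0 B1 B2 C0 C1 C2 :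
  mdegs d d d (Expo A0 A1 B0 B1 B2.+1 C0.+1 C1 C2 e3.+1) ->
  congr_mon L (Expo A0 A1 B0 B1 B2.+1 C0.+1 C1 C2 e3.+1)
              (Expo A0 A1 B0.+1 B1 B2 C0 C1 C2.+1 e3.+1).
Proof.
move=> h; have := @congr_step (f2 K) (Expo 0 0 0 0 1 1 0 0 1) (Expo 0 0 1 0 0 0 0 1 1)
  (Expo 0 0 1 0 0 1 0 1 0) (Expo 0 0 0 0 1 1 0 1 0) 0 1 2
  (Expo A0 A1 B0 B1 B2 C0 C1 C2 e3) L.
rewrite /expo_add /= !(addn0, addn1); apply=> //; move: h; rewrite /mdegs /= => -[*].
- by rewrite !inE eqxx ?orbT.
- by rewrite /f2 /mon /=; ring.
- lia.
- split; lia.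
- by apply: lower => //; split=> /=; lia.
- by apply: lower => //; split=> /=; lia.
Qed.

Lemma congr_f1 A0 A1 B0 B1 B2 C0 C1 C2 :
  mdegs d d d (Expo A0 A1 B0 B1 B2.+1 C0 C1.+1 C2 e3.+1) ->
  congr_mon L (Expo A0 A1 B0 B1 B2.+1 C0 C1.+1 C2 e3.+1)
              (Expo A0 A1 B0 B1.+1 B2 C0 C1 C2.+1 e3.+1).
Proof.
move=> h; have := @congr_step (f1 K) (Expo 0 0 0 0 1 0 1 0 1) (Expo 0 0 0 1 0 0 0 1 1)
  (Expo 0 0 0 1 0 0 1 1 0) (Expo 0 0 0 0 1 0 1 1 0) 0 1 2
  (Expo A0 A1 B0 B1 B2 C0 C1 C2 e3) L.
rewrite /expo_add /= !(addn0, addn1); apply=> //; move: h; rewrite /mdegs /= => -[*].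
- by rewrite !inE eqxx ?orbT.
- by rewrite /f1 /mon /=; ring.
- lia.
- split; lia.
- by apply: lower => //; split=> /=; lia.
- by apply: lower => //; split=> /=; lia.
Qed.

(** When c_3 is present, a monomial matters only through its a-part, its power
    of c_3 and the sums of the exponents of b_i and c_i. *)
Lemma congr_swap_bc k A0 A1 B0 B1 B2 C0 C1 C2 B0' B1' B2' C0' C1' C2' :
  (B0 - B0' + (B1 - B1') + (B2 - B2') <= k)%N ->
  mdegs d d d (Expo A0 A1 B0 B1 B2 C0 C1 C2 e3.+1) ->
  mdegs d d d (Expo A0 A1 B0' B1' B2' C0' C1' C2' e3.+1) ->
  (B0 + C0 = B0' + C0')%N -> (B1 + C1 = B1' + C1')%N ->
  (B2 + C2 = B2' + C2')%N ->
  congr_mon L (Expo A0 A1 B0 B1 B2 C0 C1 C2 e3.+1)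
              (Expo A0 A1 B0' B1' B2' C0' C1' C2' e3.+1).
Proof.
elim: k B0 B1 B2 C0 C1 C2 => [|k IH] B0 B1 B2 C0 C1 C2 hk h h' E0 E1 E2.
  have [] : [/\ B0 = B0', B1 = B1' & B2 = B2'].
    by move: h h'; rewrite /mdegs /= => -[? ? ?] [? ? ?]; split; lia.
  move=> ? ? ?; subst; have [] : [/\ C0 = C0', C1 = C1' & C2 = C2'] by split; lia.
  by move=> -> -> ->; apply: congr_refl.
have hB : (B0 + B1 + B2 = B0' + B1' + B2')%N.
  by move: h h'; rewrite /mdegs /= => -[? ? ?] [? ? ?]; lia.
have step B0n B1n B2n C0n C1n C2n :
    congr_mon L (Expo A0 A1 B0 B1 B2 C0 C1 C2 e3.+1)
      (Expo A0 A1 B0n B1n B2n C0n C1n C2n e3.+1) ->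
    (B0n - B0' + (B1n - B1') + (B2n - B2') <= k)%N ->
    (B0n + B1n + B2n = B0' + B1' + B2')%N ->
    (B0n + C0n = B0' + C0')%N -> (B1n + C1n = B1' + C1')%N ->
    (B2n + C2n = B2' + C2')%N ->
    congr_mon L (Expo A0 A1 B0 B1 B2 C0 C1 C2 e3.+1)
      (Expo A0 A1 B0' B1' B2' C0' C1' C2' e3.+1).
  move=> hs hk' hBn E0n E1n E2n; apply: congr_trans hs _; apply: IH => //.
  by move: h'; rewrite /mdegs /= => -[*]; split; lia.
set goal := congr_mon _ _ _.
have s01 : (B0' < B0)%N -> (B1 < B1')%N -> goal.
  move=> u v; have [[p pE] [q qE]] : (exists p, B0 = p.+1) /\ (exists q, C1 = q.+1).
    by split; [exists B0.-1 | exists C1.-1]; lia.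
  rewrite /goal; move: h; subst => h; apply: (@step p B1.+1 B2 C0.+1 q C2); try lia.
  by apply/congr_sym/congr_f3; move: h; rewrite /mdegs /= => -[*]; split; lia.
have s02 : (B0' < B0)%N -> (B2 < B2')%N -> goal.
  move=> u v; have [[p pE] [q qE]] : (exists p, B0 = p.+1) /\ (exists q, C2 = q.+1).
    by split; [exists B0.-1 | exists C2.-1]; lia.
  rewrite /goal; move: h; subst => h; apply: (@step p B1 B2.+1 C0.+1 C1 q); try lia.
  by apply/congr_sym/congr_f2; move: h; rewrite /mdegs /= => -[*]; split; lia.
have s10 : (B1' < B1)%N -> (B0 < B0')%N -> goal.
  move=> u v; have [[p pE] [q qE]] : (exists p, B1 = p.+1) /\ (exists q, C0 = q.+1).
    by split; [exists B1.-1 | exists C0.-1]; lia.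
  rewrite /goal; move: h; subst => h; apply: (@step B0.+1 p B2 q C1.+1 C2); try lia.
  by apply: congr_f3; move: h; rewrite /mdegs /= => -[*]; split; lia.
have s12 : (B1' < B1)%N -> (B2 < B2')%N -> goal.
  move=> u v; have [[p pE] [q qE]] : (exists p, B1 = p.+1) /\ (exists q, C2 = q.+1).
    by split; [exists B1.-1 | exists C2.-1]; lia.
  rewrite /goal; move: h; subst => h; apply: (@step B0 p B2.+1 C0 C1.+1 q); try lia.
  by apply/congr_sym/congr_f1; move: h; rewrite /mdegs /= => -[*]; split; lia.
have s20 : (B2' < B2)%N -> (B0 < B0')%N -> goal.
  move=> u v; have [[p pE] [q qE]] : (exists p, B2 = p.+1) /\ (exists q, C0 = q.+1).
    by split; [exists B2.-1 | exists C0.-1]; lia.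
  rewrite /goal; move: h; subst => h; apply: (@step B0.+1 B1 p q C1 C2.+1); try lia.
  by apply: congr_f2; move: h; rewrite /mdegs /= => -[*]; split; lia.
have s21 : (B2' < B2)%N -> (B1 < B1')%N -> goal.
  move=> u v; have [[p pE] [q qE]] : (exists p, B2 = p.+1) /\ (exists q, C1 = q.+1).
    by split; [exists B2.-1 | exists C1.-1]; lia.
  rewrite /goal; move: h; subst => h; apply: (@step B0 B1.+1 p C0 q C2.+1); try lia.
  by apply: congr_f1; move: h; rewrite /mdegs /= => -[*]; split; lia.
case: (ltngtP B0 B0') => c0; case: (ltngtP B1 B1') => c1;
  case: (ltngtP B2 B2') => c2;
  first [exact: s01 | exact: s02 | exact: s10 | exact: s12 | exact: s20 | exact: s21
     | exfalso; lia | apply: (@step B0 B1 B2 C0 C1 C2); [exact: congr_refl | lia ..]].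
Qed.

End PoleAtLast.

Section PoleAtThird.
Variable e2 : nat.
Hypothesis hL : forall x, mdegs d d d x ->
  (lead_c d x < 2 * radix d + e2.+1)%N -> (level d x < L)%N.

Let lower x : mdegs d d d x -> ec3 x = 0%N -> ec2 x = e2 -> (level d x < L)%N.
Proof.
move=> hx h3 h2; apply: hL => //; case: hx => _ _; rewrite h3 h2 => hc.
by rewrite /lead_c h3 /radix /=; do !case: ifP => ?; lia.
Qed.

Lemma congr_f4 A0 A1 B0 B1 B2 C0 C1 :
  mdegs d d d (Expo A0 A1.+1 B0 B1 B2 C0.+1 C1 e2.+1 0) ->
  congr_mon L (Expo A0 A1.+1 B0 B1 B2 C0.+1 C1 e2.+1 0)
              (Expo A0.+1 A1 B0 B1 B2 C0 C1.+1 e2.+1 0).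
Proof.
move=> h; have := @congr_step (f4 K) (Expo 0 1 0 0 0 1 0 1 0) (Expo 1 0 0 0 0 0 1 1 0)
  (Expo 1 0 0 0 0 1 1 0 0) (Expo 0 1 0 0 0 1 1 0 0) 1 0 2
  (Expo A0 A1 B0 B1 B2 C0 C1 e2 0) L.
rewrite /expo_add /= !(addn0, addn1); apply=> //; move: h; rewrite /mdegs /= => -[*].
- by rewrite !inE eqxx ?orbT.
- by rewrite /f4 /mon /=; ring.
- lia.
- split; lia.
- by apply: lower => //; split=> /=; lia.
- by apply: lower => //; split=> /=; lia.
Qed.

(** When c_2 is present but not c_3, the factors c_0, c_1 may likewise be
    exchanged with a_0, a_1. *)
Lemma congr_swap_ac k A0 A1 B0 B1 B2 C0 C1 A0' A1' C0' C1' :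
  (A0 - A0' + (A1 - A1') <= k)%N ->
  mdegs d d d (Expo A0 A1 B0 B1 B2 C0 C1 e2.+1 0) ->
  mdegs d d d (Expo A0' A1' B0 B1 B2 C0' C1' e2.+1 0) ->
  (A0 + C0 = A0' + C0')%N -> (A1 + C1 = A1' + C1')%N ->
  congr_mon L (Expo A0 A1 B0 B1 B2 C0 C1 e2.+1 0)
              (Expo A0' A1' B0 B1 B2 C0' C1' e2.+1 0).
Proof.
elim: k A0 A1 C0 C1 => [|k IH] A0 A1 C0 C1 hk h h' E0 E1.
  have [] : [/\ A0 = A0', A1 = A1', C0 = C0' & C1 = C1'].
    by move: h h'; rewrite /mdegs /= => -[? ? ?] [? ? ?]; split; lia.
  by move=> -> -> -> ->; apply: congr_refl.
have hA : (A0 + A1 = A0' + A1')%N.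
  by move: h h'; rewrite /mdegs /= => -[? ? ?] [? ? ?]; lia.
have step A0n A1n C0n C1n :
    congr_mon L (Expo A0 A1 B0 B1 B2 C0 C1 e2.+1 0)
      (Expo A0n A1n B0 B1 B2 C0n C1n e2.+1 0) ->
    (A0n - A0' + (A1n - A1') <= k)%N -> (A0n + A1n = A0' + A1')%N ->
    (A0n + C0n = A0' + C0')%N -> (A1n + C1n = A1' + C1')%N ->
    congr_mon L (Expo A0 A1 B0 B1 B2 C0 C1 e2.+1 0)
      (Expo A0' A1' B0 B1 B2 C0' C1' e2.+1 0).
  move=> hs hk' hBn E0n E1n; apply: congr_trans hs _; apply: IH => //.
  by move: h'; rewrite /mdegs /= => -[*]; split; lia.
case: (ltngtP A0 A0') => c0.
- have [[p pE] [q qE]] : (exists p, A1 = p.+1) /\ (exists q, C0 = q.+1).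
    by split; [exists A1.-1 | exists C0.-1]; lia.
  subst; apply: (@step A0.+1 p q C1.+1); try lia.
  exact: congr_f4.
- have [[p pE] [q qE]] : (exists p, A0 = p.+1) /\ (exists q, C1 = q.+1).
    by split; [exists A0.-1 | exists C1.-1]; lia.
  subst; apply: (@step p A1.+1 C0.+1 q); try lia.
  by apply/congr_sym/congr_f4; move: h; rewrite /mdegs /= => -[*]; split; lia.
- by apply: (@step A0 A1 C0 C1); [exact: congr_refl | lia ..].
Qed.

End PoleAtThird.
End Moves.

Lemma level_lt_b2 e e' : mdegs d d d e -> mdegs d d d e' ->
  ec0 e' = ec0 e -> ec1 e' = ec1 e -> ec2 e' = ec2 e -> ec3 e' = ec3 e ->
  eb2 e = (eb2 e').+1 -> (level d e' < level d e)%N.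
Proof.
case: e e' => A0 A1 B0 B1 B2 C0 C1 C2 C3 [A0' A1' B0' B1' B2' C0' C1' C2' C3'].
rewrite /mdegs /= => -[hA hB hC] [hA' hB' hC'] -> -> -> -> ->.
apply: level_lt_b => //.
rewrite /collapse /=; case: ifP => c3; last case: ifP => c2;
  by rewrite /lead_b /radix /=; do !case: ifP => ?; lia.
Qed.

(** The other terms of f_5 contain b_2 to a lower power. *)
Lemma congr_f5 A0 A1 B0 B1 B2 C0 C1 C2 C3 :
  mdegs d d d (Expo A0.+1 A1 B0 B1.+1 B2.+1 C0 C1 C2 C3) ->
  congr_mon (level d (Expo A0.+1 A1 B0 B1.+1 B2.+1 C0 C1 C2 C3))
    (Expo A0.+1 A1 B0 B1.+1 B2.+1 C0 C1 C2 C3)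
    (Expo A0 A1.+1 B0.+1 B1 B2.+1 C0 C1 C2 C3).
Proof.
move=> h; set L := level _ _; apply: congr_sym.
have := @congr_step (f5 K) (Expo 0 1 1 0 1 0 0 0 0) (Expo 1 0 0 1 1 0 0 0 0)
  (Expo 1 0 1 1 0 0 0 0 0) (Expo 0 1 1 1 0 0 0 0 0) 1 2 0
  (Expo A0 A1 B0 B1 B2 C0 C1 C2 C3) L.
have h' := h; rewrite /expo_add /= !(addn0, addn1); apply=> //;
  move: h; rewrite /mdegs /= => -[*].
- by rewrite !inE eqxx ?orbT.
- by rewrite /f5 /mon /=; ring.
- lia.
- split; lia.
- by apply: level_lt_b2 => //=; split=> /=; lia.
- by apply: level_lt_b2 => //=; split=> /=; lia.
Qed.

Lemma lead_c_eq e e' : mdegs d d d e -> mdegs d d d e' -> lead_c d e = lead_c d e' ->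
  [\/ (0 < ec3 e)%N /\ ec3 e' = ec3 e,
      [/\ (0 < ec2 e)%N, ec3 e = 0%N, ec3 e' = 0%N & ec2 e' = ec2 e]
    | [/\ ec0 e = ec0 e', ec1 e = ec1 e', ec2 e = 0%N, ec3 e = 0%N
         & ec2 e' = 0%N /\ ec3 e' = 0%N]].
Proof.
case=> _ _ hc [_ _ hc'].
rewrite /lead_c /radix; do !(case: ifP => ?); move=> h.
all: first [by exfalso; lia | by apply: Or31; split; lia
  | by apply: Or32; split; lia
  | by apply: Or33; split; [lia | lia | lia | lia | split; lia]].
Qed.

Lemma congr_collapse e e' : mdegs d d d e -> mdegs d d d e' ->
  lead_c d e = lead_c d e' -> collapse e = collapse e' ->
  congr_mon (level d e) e e'.
Proof.
move=> he he' hk; have := lead_c_eq he he' hk.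
have hL x : mdegs d d d x -> (lead_c d x < lead_c d e)%N -> (level d x < level d e)%N.
  exact: level_lt_c.
move: (level d e) hL => L hL.
case: e e' he he' hk hL => A0 A1 B0 B1 B2 C0 C1 C2 C3.
case=> A0' A1' B0' B1' B2' C0' C1' C2' C3' /= he he' _ hL.
case=> [[c3 E3]|[c2 E3 E3' E2]|[E0 E1 E2 E3 [E2' E3']]]; subst.
- rewrite /collapse /= c3 => -[hA0 hA1 h1 h2 h3].
  rewrite {}hA0 {}hA1 in he *.
  case: C3 c3 he he' hL => // e3 _ he he' hL.
  have hL' x : mdegs d d d x -> (lead_c d x < 3 * radix d + e3.+1)%N ->
    (level d x < L)%N by move=> hx hk; apply: hL.
  by apply: (congr_swap_bc hL' (leqnn _)).
- rewrite /collapse /= c2 => -[h1 h2 ? ? ?]; subst.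
  case: C2 c2 he he' hL => // e2 _ he he' hL.
  have hL' x : mdegs d d d x -> (lead_c d x < 2 * radix d + e2.+1)%N ->
    (level d x < L)%N by move=> hx hk; apply: hL.
  by apply: (congr_swap_ac hL' (leqnn _)).
- by rewrite /collapse /= => -[-> -> -> -> ->]; apply: congr_refl.
Qed.

Lemma collapse_degs e e' : mdegs d d d e -> mdegs d d d e' ->
  lead_c d e = lead_c d e' ->
  (da0 (collapse e) + da1 (collapse e) = da0 (collapse e') + da1 (collapse e')
  /\ db0 (collapse e) + db1 (collapse e) + db2 (collapse e) =
     db0 (collapse e') + db1 (collapse e') + db2 (collapse e'))%N.
Proof.
move=> he he' /(lead_c_eq he he'); case: he he' => ? ? ? [? ? ?].
rewrite /collapse => -[[? ?]|[? ? ? ?]|[? ? ? ? [? ?]]];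
  by do !(case: ifP => ? /=); split; lia.
Qed.

(** Realizes f_5 on the leading coefficient: when the collapsed monomial is
    divisible by a_0 b_1 b_2, exchanges with c bring these factors into the
    a- and b-part, where f_5 applies. *)
Lemma congr_shift e : mdegs d d d e -> (0 < da0 (collapse e))%N ->
  (0 < db1 (collapse e))%N -> (0 < db2 (collapse e))%N ->
  exists e', [/\ mdegs d d d e', level d e' = level d e,
    (db1 (collapse e)) = (db1 (collapse e')).+1 & congr_mon (level d e) e e'].
Proof.
move=> he ha hb hc.
(* It suffices to find a congruent monomial with the same collapse which is
   divisible by a0 b1 b2. *)
suff [A0 [A1 [B0 [B1 [B2 [C0 [C1 [C2 [C3 [h1 h2 h3 [h4 h5]]]]]]]]]]] :
    exists A0 A1 B0 B1 B2 C0 C1 C2 C3,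
    let e1 := Expo A0.+1 A1 B0 B1.+1 B2.+1 C0 C1 C2 C3 in
    [/\ mdegs d d d e1, lead_c d e1 = lead_c d e, collapse e1 = collapse e
      & C3 = ec3 e /\ (0 < C3 \/ C2 = ec2 e)%N].
  set e1 := Expo _ _ _ _ _ _ _ _ _ in h1 h2 h3.
  have hl : level d e1 = level d e by rewrite /level h2 h3.
  exists (Expo A0 A1.+1 B0.+1 B1 B2.+1 C0 C1 C2 C3); split.
  - by move: h1; rewrite /mdegs /= => -[*]; split; lia.
  - rewrite -hl /level; congr ((_ * _ + _) * _ + _)%N.
    + rewrite /e1 /collapse /=; case: ifP => c3; last case: ifP => c2;
        by rewrite /lead_b /= ?addSn /=; lia.
    + rewrite /e1 /collapse /=; case: ifP => c3; last case: ifP => c2;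
        by rewrite /lead_a1 /= ?addSn /=; lia.
  - rewrite -h3 /e1 /collapse /=; case: ifP => c3; last case: ifP => c2;
      by rewrite /= ?addSn /=.
  - apply: congr_trans (e1) _ _ _ _; first exact: congr_collapse.
    by rewrite -hl; apply: congr_f5.
case: e he ha hb hc => A0 A1 B0 B1 B2 C0 C1 C2 C3.
rewrite /mdegs /= => -[hA hB hC]; rewrite /collapse /=.
case: ifP => c3 /=; last case: ifP => c2 /=; move=> ha hb hc.
- exists A0.-1, A1.
  (* Distribute the d factors b: first b_1 and b_2 once each, then further
     copies of b_1, b_2 as long as there are any, and b_0 for the rest. *)
  pose x1 := (B1 + C1)%N; pose x2 := (B2 + C2)%N.
  pose y1 := minn x1.-1 (d - 2); pose y2 := minn x2.-1 (d - 2 - y1).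
  pose y0 := (d - 2 - y1 - y2)%N.
  exists y0, y1, y2, (B0 + C0 - y0)%N, (x1 - y1.+1)%N, (x2 - y2.+1)%N, C3.
  rewrite /= c3 /x1 /x2 /y0 /y1 /y2 /lead_c /= c3; split=> //; first by split; lia.
    by congr Expo5; lia.
  by split; [|left].
- have h3 : C3 = 0%N by lia.
  (* Put as many a_0 as possible into the a-part. *)
  pose x0 := minn (A0 + C0).-1 d.-1.
  exists x0, (d - x0.+1)%N, B0, B1.-1, B2.-1, (A0 + C0 - x0.+1)%N.
  exists (A1 + C1 - (d - x0.+1))%N, C2, C3.
  rewrite /= h3 /x0 /lead_c /= c2; split=> //; first by split; lia.
    by congr Expo5; lia.
  by split; [|right].
- have h3 : C3 = 0%N by lia.
  have h2 : C2 = 0%N by lia.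
  exists A0.-1, A1, B0, B1.-1, B2.-1, C0, C1, C2, C3.
  rewrite /= h3 h2 /lead_c /=; split=> //; first by split; lia.
    by congr Expo5; lia.
  by split; [|right].
Qed.

(** Within a level, the collapsed monomials form a single chain under
    a_0 b_1 -> a_1 b_0 when b_2 is present, and without b_2 they are equal. *)
Lemma congr_level e e' : mdegs d d d e -> mdegs d d d e' ->
  level d e = level d e' -> congr_mon (level d e) e e'.
Proof.
have [k] := ubnP (db1 (collapse e) - db1 (collapse e')
                  + (db1 (collapse e') - db1 (collapse e)))%N.
elim: k e e' => // k IH e e' hk he he' hl.
have [E1 E2 E3] := level_inj he he' hl.
have [Ta Tb] := collapse_degs he he' E1.
wlog lt1 : e e' hk he he' hl E1 E2 E3 Ta Tb /
    (db1 (collapse e') <= db1 (collapse e))%N.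
  move=> H; case: (leqP (db1 (collapse e')) (db1 (collapse e))) => [/H|/ltnW le1]; first exact.
  by rewrite hl; apply: congr_sym; apply: H => //; lia.
have hb0 : (db0 (collapse e) + db1 (collapse e) + db2 (collapse e) <= 2 * d)%N.
  case: he => ? ? ?; rewrite /collapse; by do !(case: ifP => //= ?); lia.
have hb2 : db2 (collapse e) = db2 (collapse e').
  move: E2; rewrite /lead_b /radix.
  by do !(case: ifP => ?); lia.
case: (ltngtP (db1 (collapse e')) (db1 (collapse e))) lt1 => // lt1 _; last first.
  apply: congr_collapse => //.
  have E3' : da1 (collapse e) = da1 (collapse e').
    by move: E3; rewrite /lead_a1 hb2; case: ifP => _; lia.
  case: (collapse e) (collapse e') Ta Tb hb2 lt1 E3' => ? ? ? ? ? [? ? ? ? ?] /=.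
  by move=> *; congr Expo5; lia.
have pos2 : (0 < db2 (collapse e))%N.
  rewrite lt0n; apply/eqP => z; move: E2; rewrite /lead_b -hb2 z /radix /=.
  by do !(case: ifP => ?); lia.
have [||//|e1 [h1 l1 s1 c1]] := congr_shift he; try lia.
  by move: E3; rewrite /lead_a1 -hb2 pos2; lia.
apply: congr_trans c1 _; rewrite -l1; apply: IH => //; last by rewrite l1.
by rewrite s1 in lt1 hk *; lia.
Qed.

(* V stands for the polynomials that vanish on the image. *)
Variable V : S -> Prop.
Hypothesis VB : forall p q, V p -> V q -> V (p - q).
Hypothesis ZV : forall p, Z p -> V p.
Hypothesis top_coef_sum0 : forall q L, V q ->
  (forall m, m \in msupp q ->
     mdegs d d d (expo_of m) /\ (level d (expo_of m) <= L)%N) ->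
  \sum_(m <- msupp q | level d (expo_of m) == L) q@_m = 0.

Lemma low_sum L (I : eqType) (r : seq I) (P : pred I) (F : I -> S) :
  (forall i, i \in r -> P i -> low L (F i)) -> low L (\sum_(i <- r | P i) F i).
Proof.
move=> hF; rewrite big_seq_cond.
elim/big_ind: _ => [|p q hp hq|i /andP[ir Pi]]; last exact: hF.
  exact: low_of_Z.
exact: lowD.
Qed.

Lemma below_Z L q : V q -> below L q -> Z q.
Proof.
elim: L q => [|L IH] q hV hq.
  suff -> : q = 0 by [].
  by apply: msuppnil0; case E: (msupp q) => [//|m s]; have [] := hq m;
    rewrite ?E ?mem_head.
have hle m : m \in msupp q ->
    mdegs d d d (expo_of m) /\ (level d (expo_of m) <= L)%N.
  by move=> /hq[].
have sum0 := top_coef_sum0 hV hle.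
suff [j [h [hj hh qE]]] : low L q.
  have hh' : Z h.
    by apply: IH hh; rewrite -[h](addKr j) -qE addrC; apply/VB/ZV.
  by rewrite qE; apply: ZD.
rewrite (mpolyE q) (bigID (fun m => level d (expo_of m) == L)) /=.
apply: lowD; last first.
  apply: low_sum => m mq hm; have [h1 h2] := hle m mq.
  apply/lowZ/low_below; rewrite -mon_expo_of; apply: below_mon => //.
  by rewrite ltn_neqAle hm.
(* The top coefficients have sum 0, so each top monomial may be replaced by its
   difference with a fixed one. *)
have [/hasP[m0 m0q /eqP hm0]|no] :=
    boolP (has (fun m => level d (expo_of m) == L) (msupp q)); last first.
  rewrite big_seq_cond big_pred0; first exact: low_of_Z.
  by move=> m; apply/andP => -[mq hm]; case/hasP: no; exists m.
rewrite (_ : \sum_(m <- _ | _) _ =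
    \sum_(m <- msupp q | level d (expo_of m) == L)
      q@_m *: ('X_[m] - 'X_[m0])); last first.
  under [RHS]eq_bigr do rewrite scalerBr.
  by rewrite sumrB -scaler_suml sum0 scale0r subr0.
apply: low_sum => m mq /eqP hm; apply: lowZ.
have [[dm _] [dm0 _]] := (hle m mq, hle m0 m0q).
have := congr_level dm dm0; rewrite hm hm0 => /(_ erefl).
by rewrite /congr_mon !mon_expo_of.
Qed.
End Straightening.

(** * Poles and leading coefficients *)
Section Poles.
Variable K : numFieldType.

Lemma poly_cofinite0 (F : seq K) (p : {poly K}) :
  (forall t, t \notin F -> p.[t] = 0) -> p = 0.
Proof.
move=> hp; apply/eqP; apply: contraT => p0.
pose q := p * \prod_(z <- F) ('X - z%:P).
have q0 : q != 0 by rewrite mulf_neq0 // monic_neq0 // monic_prod_XsubC.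
have := @max_poly_roots _ q [seq i%:R | i <- iota 0 (size q)] q0.
rewrite size_map size_iota ltnn => -> //.
  apply/allP => t _; rewrite rootE hornerM horner_prod.
  have [tF|/hp->] := boolP (t \in F); last by rewrite mul0r.
  by rewrite (perm_big _ (perm_to_rem tF)) big_cons /= hornerXsubC subrr mul0r mulr0.
rewrite map_inj_uniq ?iota_uniq // => i j /eqP.
by rewrite eqr_nat => /eqP.
Qed.

(** The leading coefficient of a vanishing sum of products of powers of
    1 / (t - y_i) at its highest possible pole t = y_k: clear denominators and
    evaluate at y_k. *)
Lemma pole (T : eqType) (r : seq T) (w : T -> K) (g : T -> nat -> nat)
    (y : nat -> K) (F : seq K) (k e D : nat) :
  (forall i, (i < k)%N -> y i != y k) ->
  (forall x, x \in r -> (g x k <= e)%N /\ forall i, (i < k)%N -> (g x i <= D)%N) ->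
  (forall t, t \notin F -> \sum_(x <- r)
     w x * ((\prod_(i < k) (t - y i)^-1 ^+ g x i) * (t - y k)^-1 ^+ g x k) = 0) ->
  \sum_(x <- r | g x k == e) w x * \prod_(i < k) (y k - y i)^-1 ^+ g x i = 0.
Proof.
move=> hy hg hF.
(* The sum multiplied by the product of the (t - y_i)^D for i < k and by
   (t - y_k)^e. *)
pose p := \sum_(x <- r) w x *: ((\prod_(i < k) ('X - (y i)%:P) ^+ (D - g x i))
  * ('X - (y k)%:P) ^+ (e - g x k)).
have hexp (z : K) a b : z != 0 -> (a <= b)%N -> z ^+ (b - a) = z ^+ b * z^-1 ^+ a.
  by move=> z0 ab; rewrite exprB ?unitfE // exprVn.
have p0 : p = 0.
  apply: (@poly_cofinite0 (F ++ [seq y i | i <- iota 0 k.+1])) => t.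
  rewrite mem_cat negb_or => /andP[tF ty].
  have tn i : (i <= k)%N -> t - y i != 0.
    move=> ik; rewrite subr_eq0; apply: contraNneq ty => ->.
    by apply: map_f; rewrite mem_iota /= add0n ltnS.
  rewrite /p horner_sum.
  transitivity ((\prod_(i < k) (t - y i) ^+ D) * (t - y k) ^+ e *
    \sum_(x <- r) w x * ((\prod_(i < k) (t - y i)^-1 ^+ g x i)
      * (t - y k)^-1 ^+ g x k)); last by rewrite hF ?mulr0.
  rewrite mulr_sumr big_seq [RHS]big_seq; apply: eq_bigr => x xr.
  have [h1 h2] := hg x xr.
  rewrite hornerZ hornerM horner_prod horner_exp hornerXsubC hexp ?tn //.
  rewrite (eq_bigr (fun i : 'I_k => (t - y i) ^+ D * (t - y i)^-1 ^+ g x i)).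
    by rewrite big_split /=; ring.
  by move=> i _; rewrite horner_exp hornerXsubC hexp ?h2 // tn // ltnW.
have : p.[y k] = 0 by rewrite p0 horner0.
have yn : \prod_(i < k) (y k - y i) ^+ D != 0.
  by apply/prodf_neq0 => i _; rewrite expf_neq0 // subr_eq0 eq_sym hy.
rewrite /p horner_sum (bigID (fun x => g x k == e)) /=.
rewrite [X in _ + X]big_seq_cond [X in _ + X]big1 ?addr0; last first.
  move=> x /andP[xr xe]; have [h1 _] := hg x xr.
  rewrite hornerZ hornerM horner_exp hornerXsubC subrr expr0n subn_eq0 leqNgt.
  by rewrite ltn_neqAle xe h1 mulr0 mulr0.
move=> h; apply: (mulfI yn); rewrite mulr0 -[RHS]h mulr_sumr.
rewrite [LHS]big_seq_cond [RHS]big_seq_cond; apply: eq_bigr => x /andP[xr /eqP xe].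
have [_ h2] := hg x xr.
rewrite hornerZ hornerM horner_exp hornerXsubC subrr xe subnn expr0 mulr1.
rewrite horner_prod mulrCA -big_split /=; congr (_ * _).
apply: eq_bigr => i _; rewrite horner_exp hornerXsubC hexp ?h2 //.
by rewrite subr_eq0 eq_sym hy.
Qed.

(** The coordinates given by y on the locus of smooth curves, the first marked
    point being at infinity. *)
Definition smooth_row (k : nat) (y : nat -> K) : 'rV[K]_k :=
  \row_(i < k) (y k - y i)^-1.

Definition distinct_upto (n : nat) (y : nat -> K) : Prop :=
  forall i j, (i < j < n)%N -> y j - y i != 0.

Definition vanishing (q : {mpoly K[2 + (3 + 4)]}) : Prop :=
  forall y, distinct_upto 5 y ->
    q.@[coords (smooth_row 2 y) (smooth_row 3 y) (smooth_row 4 y)] = 0.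

Definition eval5 (y : nat -> K) (g : expo5) : K :=
  (y 2%N - y 0%N)^-1 ^+ da0 g * (y 2%N - y 1%N)^-1 ^+ da1 g *
  ((y 3%N - y 0%N)^-1 ^+ db0 g * (y 3%N - y 1%N)^-1 ^+ db1 g
   * (y 3%N - y 2%N)^-1 ^+ db2 g).

Lemma mevalXn n (v : 'I_n -> K) (p : {mpoly K[n]}) k :
  (p ^+ k).@[v] = p.@[v] ^+ k.
Proof. exact: rmorphXn. Qed.

Lemma meval_avar (v : 'I_(2 + (3 + 4)) -> K) i :
  (avar K 0 i).@[v] = v (lshift (3 + 4) i).
Proof. by rewrite mxE mevalXU. Qed.

Lemma meval_bvar (v : 'I_(2 + (3 + 4)) -> K) i :
  (bvar K 0 i).@[v] = v (rshift 2 (lshift 4 i)).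
Proof. by rewrite mxE mevalXU. Qed.

Lemma meval_cvar (v : 'I_(2 + (3 + 4)) -> K) i :
  (cvar K 0 i).@[v] = v (rshift 2 (rshift 3 i)).
Proof. by rewrite mxE mevalXU. Qed.

Lemma coords_a (a : 'rV[K]_2) b c i : coords a b c (lshift (3 + 4) i) = a 0 i.
Proof. by rewrite /coords row_mxEl. Qed.

Lemma coords_b (a : 'rV[K]_2) b c i :
  coords a b c (rshift 2 (lshift 4 i)) = b 0 i.
Proof. by rewrite /coords row_mxEr row_mxEl. Qed.

Lemma coords_c (a : 'rV[K]_2) b c i :
  coords a b c (rshift 2 (rshift 3 i)) = c 0 i.
Proof. by rewrite /coords !row_mxEr. Qed.

Definition meval_var :=
  (meval_avar, meval_bvar, meval_cvar, coords_a, coords_b, coords_c).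

Lemma meval_mon (y : nat -> K) e :
  (mon K e).@[coords (smooth_row 2 y) (smooth_row 3 y) (smooth_row 4 y)] =
  eval5 y (Expo5 (ea0 e) (ea1 e) (eb0 e) (eb1 e) (eb2 e)) *
  ((y 4%N - y 0%N)^-1 ^+ ec0 e * (y 4%N - y 1%N)^-1 ^+ ec1 e *
   (y 4%N - y 2%N)^-1 ^+ ec2 e * (y 4%N - y 3%N)^-1 ^+ ec3 e).
Proof.
by rewrite /mon !mevalM !mevalXn !meval_var !mxE !inordK.
Qed.
End Poles.

Section LeadingSum.
Variable K : numFieldType.
Local Notation S := {mpoly K[2 + (3 + 4)]}.
Variable d : nat.

Definition cexp e := nth 0%N [:: ec0 e; ec1 e; ec2 e; ec3 e].
Definition abpart e := Expo5 (ea0 e) (ea1 e) (eb0 e) (eb1 e) (eb2 e).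

(** Leading coefficients in t = y_4.  The normalization of y_1 - y_0 makes the
    factors left over at the pole y_4 = y_1 equal to 1. *)
Lemma pole_c (T : eqType) (r : seq T) (E : T -> expo) (u : T -> K) (m0 : T)
    (y : nat -> K) :
  mdegs d d d (E m0) ->
  (forall m, m \in r ->
     mdegs d d d (E m) /\ (lead_c d (E m) <= lead_c d (E m0))%N) ->
  distinct_upto 4 y -> y 1%N - y 0%N = 1 ->
  (forall t, t \notin [seq y i | i <- iota 0 4] ->
   \sum_(m <- r) (u m * eval5 y (abpart (E m))) *
     ((t - y 0%N)^-1 ^+ ec0 (E m) * (t - y 1%N)^-1 ^+ ec1 (E m) *
      (t - y 2%N)^-1 ^+ ec2 (E m) * (t - y 3%N)^-1 ^+ ec3 (E m)) = 0) ->
  \sum_(m <- r | lead_c d (E m) == lead_c d (E m0))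
     u m * eval5 y (collapse (E m)) = 0.
Proof.
move=> h0 hr hy hy1; set F := [seq y i | i <- iota 0 4] => hF.
have hD m : m \in r -> forall i, (cexp (E m) i <= d)%N.
  move=> /hr[[_ _ hc] _] i; rewrite /cexp -hc.
  by case: i => [|[|[|[|i]]]] /=; rewrite ?nth_nil; lia.
have main k (e := cexp (E m0) k) : (k < 4)%N ->
    (forall m, m \in r -> (cexp (E m) k <= e)%N /\
       forall i, (k < i < 4)%N -> cexp (E m) i = 0%N) ->
    \sum_(m <- r | cexp (E m) k == e)
      (u m * eval5 y (abpart (E m)))
      * \prod_(i < k) (y k - y i)^-1 ^+ cexp (E m) i = 0.
  move=> k4 hk; apply: (@pole _ _ _ _ (fun m => cexp (E m)) y F k e d).
  - by move=> i ik; rewrite eq_sym -subr_eq0; apply: hy; rewrite ik.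
  - by move=> m mq; split=> [|i _]; [case: (hk m mq) | exact: hD].
  move=> t ht; rewrite -[RHS](hF t ht).
  rewrite big_seq [RHS]big_seq; apply: eq_bigr => m mq.
  have [_ hk0] := hk m mq; congr (_ * _).
  have c1 : (k < 1)%N -> ec1 (E m) = 0%N by move=> ?; apply: (hk0 1%N); lia.
  have c2 : (k < 2)%N -> ec2 (E m) = 0%N by move=> ?; apply: (hk0 2%N); lia.
  have c3 : (k < 3)%N -> ec3 (E m) = 0%N by move=> ?; apply: (hk0 3%N); lia.
  case: k k4 {e hk hk0} c1 c2 c3 => [|[|[|[|//]]]] _ c1 c2 c3;
    rewrite ?big_ord_recr big_ord0 /cexp /=.
  - by rewrite c1 // c2 // c3 // !expr0 !mulr1 mul1r.
  - by rewrite c2 // c3 // !expr0 !mulr1 mul1r.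
  - by rewrite c3 // !expr0 !mulr1 mul1r.
  - by rewrite mul1r.
have finish k (e := cexp (E m0) k) : (k < 4)%N ->
    (forall m, m \in r -> (cexp (E m) k <= e)%N /\
       forall i, (k < i < 4)%N -> cexp (E m) i = 0%N) ->
    (forall m, m \in r -> (lead_c d (E m) == lead_c d (E m0)) = (cexp (E m) k == e)) ->
    (forall m, m \in r -> cexp (E m) k == e -> eval5 y (collapse (E m)) =
       eval5 y (abpart (E m)) * \prod_(i < k) (y k - y i)^-1 ^+ cexp (E m) i) ->
    \sum_(m <- r | lead_c d (E m) == lead_c d (E m0))
     u m * eval5 y (collapse (E m)) = 0.
  move=> k4 hk heq hev; rewrite -[RHS](main k k4 hk) big_seq_cond [RHS]big_seq_cond.
  apply: eq_big => [m|m /andP[mq he]]; first by case: (boolP (m \in _)) => //= /heq.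
  by rewrite -mulrA -hev // -heq.
case: (h0) => _ _ hc0.
have [z3|p3] := posnP (ec3 (E m0)); last first.
  apply: (finish 3) => // m /hr[[_ _ hc] hm]; rewrite /cexp /=.
  - split; last by lia.
    by move: hm; rewrite /lead_c /radix p3; do !case: ifP => ?; lia.
  - by move: hm; rewrite /lead_c /radix p3; do !case: ifP => ?; lia.
  - move=> /eqP e3; rewrite /collapse e3 p3 /eval5 /= !big_ord_recr big_ord0 /=.
    by rewrite !exprD; ring.
have [z2|p2] := posnP (ec2 (E m0)); last first.
  have hm3 m : m \in r -> ec3 (E m) = 0%N.
    move=> /hr[[_ _ hc]]; rewrite /lead_c /radix z3 p2 /=; do !case: ifP => ?; lia.
  apply: (finish 2) => // m mq; have := hm3 m mq; move: mq => /hr[[_ _ hc] hm] c3;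
    rewrite /cexp /=.
  - split; last by move=> i ?; have -> : i = 3 by lia.
    by move: hm; rewrite /lead_c /radix z3 p2 c3 /=; do !case: ifP => ?; lia.
  - by move: hm; rewrite /lead_c /radix z3 p2 c3 /=; do !case: ifP => ?; lia.
  - move=> /eqP e2; rewrite /collapse c3 e2 p2 /eval5 /= !big_ord_recr big_ord0 /=.
    by rewrite !exprD; ring.
have hm3 m : m \in r -> ec3 (E m) = 0%N /\ ec2 (E m) = 0%N.
  move=> /hr[[_ _ hc]]; rewrite /lead_c /radix z3 z2 /=; do !case: ifP => ?; lia.
have [z1|p1] := posnP (ec1 (E m0)); last first.
  apply: (finish 1) => // m mq; have := hm3 m mq;
    move: mq => /hr[[_ _ hc] hm] [c3 c2]; rewrite /cexp /=.
  - split; last by move=> i ?; have [->|->] : i = 2 \/ i = 3 by lia.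
    by move: hm; rewrite /lead_c /radix z3 z2 p1 c3 c2 /=; do !case: ifP => ?; lia.
  - by move: hm; rewrite /lead_c /radix z3 z2 p1 c3 c2 /=; do !case: ifP => ?; lia.
  - move=> _; rewrite /collapse c3 c2 /eval5 /= !big_ord_recr big_ord0 /=.
    by rewrite hy1 invr1 expr1n !mulr1.
have hm1 m : m \in r -> ec1 (E m) = 0%N.
  move=> /hr[[_ _ hc]]; rewrite /lead_c /radix z3 z2 z1 /=; do !case: ifP => ?; lia.
apply: (finish 0) => // m mq; have := hm1 m mq; have := hm3 m mq;
    move: mq => /hr[[_ _ hc] hm] [c3 c2] c1; rewrite /cexp /=.
- split; last by move=> i ?; have [->|[->|->]] : i = 1 \/ i = 2 \/ i = 3 by lia.
  lia.
- by rewrite /lead_c c1 c2 c3 z1 z2 z3.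
- by move=> _; rewrite /collapse c3 c2 /= big_ord0 mulr1.
Qed.

(** The exponent of a_0 once y_3 has been moved to its pole. *)
Definition lead_a0 g := (if 0 < db2 g then da0 g + db0 g else da0 g)%N.
Definition bexp g := nth 0%N [:: db0 g; db1 g; db2 g].

(** Leading coefficients in t = y_3. *)
Lemma pole_b (T : eqType) (r : seq T) (G : T -> expo5) (u : T -> K) (m0 : T)
    (y : nat -> K) N :
  (N <= 2 * d)%N -> (db0 (G m0) + db1 (G m0) + db2 (G m0) = N)%N ->
  (forall m, m \in r -> (db0 (G m) + db1 (G m) + db2 (G m) = N)%N /\
     (lead_b d (G m) <= lead_b d (G m0))%N) ->
  distinct_upto 3 y -> y 1%N - y 0%N = 1 ->
  (forall t, t \notin [seq y i | i <- iota 0 3] ->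
   \sum_(m <- r) (u m * ((y 2%N - y 0%N)^-1 ^+ da0 (G m) *
       (y 2%N - y 1%N)^-1 ^+ da1 (G m))) *
     ((t - y 0%N)^-1 ^+ db0 (G m) * (t - y 1%N)^-1 ^+ db1 (G m) *
      (t - y 2%N)^-1 ^+ db2 (G m)) = 0) ->
  \sum_(m <- r | lead_b d (G m) == lead_b d (G m0))
     u m * ((y 2%N - y 0%N)^-1 ^+ lead_a0 (G m) *
            (y 2%N - y 1%N)^-1 ^+ lead_a1 (G m)) = 0.
Proof.
move=> hN h0 hr hy hy1; set F := [seq y i | i <- iota 0 3] => hF.
pose w m := u m * ((y 2%N - y 0%N)^-1 ^+ da0 (G m) *
                   (y 2%N - y 1%N)^-1 ^+ da1 (G m)).
have hD m : m \in r -> forall i, (bexp (G m) i <= N)%N.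
  move=> /hr[hc _] i; rewrite /bexp -hc.
  by case: i => [|[|[|i]]] /=; rewrite ?nth_nil; lia.
have main k (e := bexp (G m0) k) : (k < 3)%N ->
    (forall m, m \in r -> (bexp (G m) k <= e)%N /\
       forall i, (k < i < 3)%N -> bexp (G m) i = 0%N) ->
    \sum_(m <- r | bexp (G m) k == e)
      w m * \prod_(i < k) (y k - y i)^-1 ^+ bexp (G m) i = 0.
  move=> k3 hk; apply: (@pole _ _ _ _ (fun m => bexp (G m)) y F k e N).
  - by move=> i ik; rewrite eq_sym -subr_eq0; apply: hy; rewrite ik.
  - by move=> m mr; split=> [|i _]; [case: (hk m mr) | exact: hD].
  move=> t ht; rewrite -[RHS](hF t ht).
  rewrite big_seq [RHS]big_seq; apply: eq_bigr => m mr.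
  have [_ hk0] := hk m mr; congr (_ * _).
  have c1 : (k < 1)%N -> db1 (G m) = 0%N by move=> ?; apply: (hk0 1%N); lia.
  have c2 : (k < 2)%N -> db2 (G m) = 0%N by move=> ?; apply: (hk0 2%N); lia.
  case: k k3 {e hk hk0} c1 c2 => [|[|[|//]]] _ c1 c2;
    rewrite ?big_ord_recr big_ord0 /bexp /=.
  - by rewrite c1 // c2 // !expr0 !mulr1 mul1r.
  - by rewrite c2 // !expr0 !mulr1 mul1r.
  - by rewrite mul1r.
have finish k (e := bexp (G m0) k) : (k < 3)%N ->
    (forall m, m \in r -> (bexp (G m) k <= e)%N /\
       forall i, (k < i < 3)%N -> bexp (G m) i = 0%N) ->
    (forall m, m \in r -> (lead_b d (G m) == lead_b d (G m0)) = (bexp (G m) k == e)) ->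
    (forall m, m \in r -> bexp (G m) k == e ->
       u m * ((y 2%N - y 0%N)^-1 ^+ lead_a0 (G m) *
              (y 2%N - y 1%N)^-1 ^+ lead_a1 (G m)) =
       w m * \prod_(i < k) (y k - y i)^-1 ^+ bexp (G m) i) ->
    \sum_(m <- r | lead_b d (G m) == lead_b d (G m0))
     u m * ((y 2%N - y 0%N)^-1 ^+ lead_a0 (G m) *
            (y 2%N - y 1%N)^-1 ^+ lead_a1 (G m)) = 0.
  move=> k3 hk heq hev; rewrite -[RHS](main k k3 hk) big_seq_cond [RHS]big_seq_cond.
  apply: eq_big => [m|m /andP[mr he]]; first by case: (boolP (m \in _)) => //= /heq.
  by rewrite -hev // -heq.
have [z2|p2] := posnP (db2 (G m0)); last first.
  apply: (finish 2) => // m /hr[hc hm]; rewrite /bexp /=.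
  - split; last by lia.
    by move: hm; rewrite /lead_b /radix p2; do !case: ifP => ?; lia.
  - by move: hm; rewrite /lead_b /radix p2; do !case: ifP => ?; lia.
  - move=> /eqP e2; rewrite /w /lead_a0 /lead_a1 e2 p2 !big_ord_recr big_ord0 /=.
    by rewrite !exprD; ring.
have hm3 m : m \in r -> db2 (G m) = 0%N.
  move=> /hr[hc]; rewrite /lead_b /radix z2 /=; do !case: ifP => ?; lia.
have [z1|p1] := posnP (db1 (G m0)); last first.
  apply: (finish 1) => // m mr; have := hm3 m mr;
    move: mr => /hr[hc hm] c2; rewrite /bexp /=.
  - split; last by move=> i ?; have -> : i = 2 by lia.
    by move: hm; rewrite /lead_b /radix z2 p1 c2 /=; do !case: ifP => ?; lia.
  - by move: hm; rewrite /lead_b /radix z2 p1 c2 /=; do !case: ifP => ?; lia.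
  - move=> _; rewrite /w /lead_a0 /lead_a1 c2 /= !big_ord_recr big_ord0 /=.
    by rewrite hy1 invr1 expr1n !mulr1.
have hm1 m : m \in r -> db1 (G m) = 0%N.
  move=> /hr[hc]; rewrite /lead_b /radix z2 z1 /=; do !case: ifP => ?; lia.
apply: (finish 0) => // m mr; have := hm1 m mr; have := hm3 m mr;
    move: mr => /hr[hc hm] c2 c1; rewrite /bexp /=.
- split; last by move=> i ?; have [->|->] : i = 1 \/ i = 2 by lia.
  lia.
- by rewrite /lead_b c1 c2 z1 z2.
- by move=> _; rewrite /w /lead_a0 /lead_a1 c2 /= big_ord0 mulr1.
Qed.

(** Leading coefficients in t = y_2. *)
Lemma pole_a (T : eqType) (r : seq T) (u : T -> K) (p k : T -> nat) (m0 : T)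
    (y0 y1 : K) N :
  y1 - y0 = 1 -> (forall m, m \in r -> (k m <= k m0)%N /\ (p m <= N)%N) ->
  (forall t, t \notin [:: y0; y1] ->
   \sum_(m <- r) u m * ((t - y0)^-1 ^+ p m * (t - y1)^-1 ^+ k m) = 0) ->
  \sum_(m <- r | k m == k m0) u m = 0.
Proof.
move=> hy1 hr hF.
have := @pole K T r u (fun m i => if i == 0%N then p m else k m)
  (fun i => if i == 0%N then y0 else y1) [:: y0; y1] 1 (k m0) N.
rewrite /= => H; rewrite -[RHS]H //.
- by apply: eq_bigr => m _; rewrite big_ord1 /= hy1 invr1 expr1n mulr1.
- by case=> // _; rewrite /= eq_sym -subr_eq0 hy1 oner_neq0.
- by move=> m /hr[h1 h2]; split=> // -[|//] _.
- move=> t /hF ht; rewrite -[RHS]ht; apply: eq_bigr => m _.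
  by rewrite big_ord1.
Qed.

Lemma collapse_bounds e : mdegs d d d e ->
  (db0 (collapse e) + db1 (collapse e) + db2 (collapse e) <= 2 * d)%N /\
  (lead_a0 (collapse e) <= 3 * d)%N.
Proof.
case=> ? ? ?; rewrite /lead_a0 /collapse.
by do !(case: ifP => ? /=); split; lia.
Qed.

Definition extend n (y : nat -> K) (t : K) i := if i == n then t else y i.

Lemma distinct_extend n y t : distinct_upto n y ->
  t \notin [seq y i | i <- iota 0 n] -> distinct_upto n.+1 (extend n y t).
Proof.
move=> hy ht i j /andP[ij jn]; rewrite /extend (_ : (i == n) = false); last by lia.
case: (j =P n) => [_|hj]; last by apply: hy; lia.
rewrite subr_eq0; apply: contraNneq ht => ->; apply: map_f.
by rewrite mem_iota; lia.
Qed.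

Local Notation E := expo_of.

Lemma vanish_in_y4 (q : S) (y : nat -> K) t : vanishing q ->
  distinct_upto 4 y -> t \notin [seq y i | i <- iota 0 4] ->
  \sum_(m <- msupp q) (q@_m * eval5 y (abpart (E m))) *
     ((t - y 0%N)^-1 ^+ ec0 (E m) * (t - y 1%N)^-1 ^+ ec1 (E m) *
      (t - y 2%N)^-1 ^+ ec2 (E m) * (t - y 3%N)^-1 ^+ ec3 (E m)) = 0.
Proof.
move=> hq hy ht; rewrite -[RHS](hq _ (distinct_extend hy ht)).
rewrite [in RHS](mpolyE q) raddf_sum /=.
by apply: eq_bigr => m _; rewrite mevalZ -mon_expo_of meval_mon -mulrA.
Qed.

(** After three successive leading coefficients no variable is left. *)
Lemma top_coef_sum0 (q : S) L : vanishing q ->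
  (forall m, m \in msupp q ->
     mdegs d d d (expo_of m) /\ (level d (expo_of m) <= L)%N) ->
  \sum_(m <- msupp q | level d (expo_of m) == L) q@_m = 0.
Proof.
move=> hq hr.
have [/hasP[m0 m0q /eqP hm0]|no] :=
    boolP (has (fun m => level d (expo_of m) == L) (msupp q)); last first.
  rewrite big_seq_cond big_pred0 // => m.
  by apply/andP => -[mq hm]; case/hasP: no; exists m.
have [h0 _] := hr m0 m0q.
have hle m : m \in msupp q -> (level d (E m) <= level d (E m0))%N.
  by rewrite hm0 => /hr[].
have hk m (mq : m \in msupp q) := level_le (proj1 (hr m mq)) h0 (hle m mq).
have hk1 m (mq : m \in msupp q) := proj1 (hk m mq).
have hk23 m (mq : m \in msupp q) := proj2 (hk m mq).
pose r1 := [seq m <- msupp q | lead_c d (E m) == lead_c d (E m0)].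
have S1 y : distinct_upto 4 y -> y 1%N - y 0%N = 1 ->
    \sum_(m <- r1) q@_m * eval5 y (collapse (E m)) = 0.
  move=> hy hy1; rewrite big_filter; apply: pole_c => // [m mq|t ht].
    by split; [case: (hr m mq) | exact: hk1].
  exact: vanish_in_y4.
pose G m := collapse (E m).
pose r2 := [seq m <- r1 | lead_b d (G m) == lead_b d (G m0)].
pose N := (db0 (G m0) + db1 (G m0) + db2 (G m0))%N.
have hN : (N <= 2 * d)%N.
  by have [] := collapse_bounds h0.
have S2 y : distinct_upto 3 y -> y 1%N - y 0%N = 1 ->
    \sum_(m <- r2) q@_m * ((y 2%N - y 0%N)^-1 ^+ lead_a0 (G m) *
            (y 2%N - y 1%N)^-1 ^+ lead_a1 (G m)) = 0.
  move=> hy hy1; rewrite big_filter; apply: (pole_b hN erefl) => // [m|t ht].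
    rewrite mem_filter => /andP[/eqP e1 mq].
    have [_ hb] := collapse_degs (proj1 (hr m mq)) h0 e1.
    by split; [exact: hb | case: (hk23 m mq e1)].
  rewrite -[RHS](S1 (extend 3 y t)) //; last exact: distinct_extend.
  by apply: eq_bigr => m _; rewrite -mulrA.
have S3 : \sum_(m <- r2 | lead_a1 (G m) == lead_a1 (G m0)) q@_m = 0.
  apply: (@pole_a _ r2 (fun m => q@_m) (lead_a0 \o G) (lead_a1 \o G) m0 0 1 (3 * d)).
  - by rewrite subr0.
  - move=> m; rewrite !mem_filter => /andP[/eqP e2 /andP[/eqP e1 mq]]; split.
      by have [_] := hk23 m mq e1; apply.
    by have [] := collapse_bounds (proj1 (hr m mq)).
  - move=> t ht; pose y i := if i is 0%N then 0 else 1 : K.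
    rewrite -[RHS](S2 (extend 2 y t)) //; last by rewrite /extend /= subr0.
    apply: distinct_extend => // i j hij.
    have [-> ->] : i = 0%N /\ j = 1%N by lia.
    by rewrite /y subr0 oner_neq0.
rewrite -[RHS]S3 !big_filter_cond.
rewrite big_seq_cond [RHS]big_seq_cond; apply: eq_bigl => m.
have [mq|//] := boolP (m \in msupp q); have [hm _] := hr m mq; rewrite /= -hm0.
apply/eqP/idP => [/(level_inj hm h0)[-> -> ->]|]; first by rewrite /G !eqxx.
by rewrite /level => /and3P[/eqP-> /eqP-> /eqP->].
Qed.

End LeadingSum.

(** * The generators vanish on stable curves *)
Section Brackets.
Variable K : fieldType.

(** The common shape of f_1, ..., f_5. *)
Definition generator_form (b b' c c' c'' : K) :=
  b * c * c' - b' * c * c' + b' * c * c'' - b * c' * c''.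

Lemma br_refl (P : 'rV[K]_2) : br P P = 0.
Proof. by rewrite /br mulrC subrr. Qed.

Lemma br_sym0 (P Q : 'rV[K]_2) : (br P Q == 0) = (br Q P == 0).
Proof. by rewrite -oppr_eq0 /br opprB mulrC [in RHS]addrC [X in _ - X]mulrC addrC. Qed.

Lemma generator_form_same (P1 P P' P5 P6 : 'rV[K]_2) :
  br P5 P != 0 -> br P5 P' != 0 -> br P6 P != 0 -> br P6 P' != 0 ->
  br P6 P5 != 0 ->
  generator_form (br P1 P / br P5 P) (br P1 P' / br P5 P') (br P1 P / br P6 P)
    (br P1 P' / br P6 P') (br P1 P5 / br P6 P5) = 0.
Proof. by rewrite /generator_form /br => *; field; do ?[apply/andP; split]. Qed.

(** Two components, with X the direction of the second seen from the first and Y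
    the direction of the first seen from the second: x_i and y_i are the images
    of the i-th marked point on each.  Coinciding points make some of the factors
    zero or equal, and in each case the terms cancel. *)
Lemma generator_form_apart (X Y : 'rV[K]_2) (x1 xp xp' x5 y1 yp yp' y5 y6 : 'rV[K]_2) :
  x1 = X \/ y1 = Y -> xp = X \/ yp = Y -> xp' = X \/ yp' = Y ->
  x5 = X \/ y5 = Y ->
  br x5 x1 != 0 -> br x5 xp != 0 -> br x5 xp' != 0 ->
  generator_form (br x1 xp / br x5 xp) (br x1 xp' / br x5 xp') (br y1 yp / br y6 yp)
    (br y1 yp' / br y6 yp') (br y1 y5 / br y6 y5) = 0.
Proof.
rewrite /generator_form => h1 hp hp' h5 n1 np np'.
have no5 z w : (z = X \/ w = Y) -> br x5 z != 0 -> x5 = X -> w = Y.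
  by case=> // -> nz e5; move: nz; rewrite e5 br_refl eqxx.
case: h5 => [e5|->].
  rewrite (no5 _ _ h1 n1 e5) (no5 _ _ hp np e5) (no5 _ _ hp' np' e5) br_refl.
  by rewrite !mul0r; ring.
case: h1 => [->|->]; case: hp => [->|->]; case: hp' => [->|->];
  by rewrite ?br_refl ?mul0r; ring.
Qed.

End Brackets.

Section Trees.
Variable K : fieldType.
Variables (n : nat) (G : stable_curve K n).
Local Notation node := (@node K n G).

Definition simple_path v (p : seq (component G)) w :=
  [&& path node v p, uniq (v :: p) & last v p == w].

Lemma simple_path_unique v w p q :
  simple_path v p w -> simple_path v q w -> p = q.
Proof. by have [r [_ hr]] := node_tree v w; move=> /hr <- /hr. Qed.

Lemma simple_path_exists v w : exists p, simple_path v p w.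
Proof. by have [r [hr _]] := node_tree v w; exists r. Qed.

Lemma simple_path_through v p w x : simple_path v p w -> x \in p ->
  exists p1 p2, p = rcons p1 x ++ p2 /\ simple_path v (rcons p1 x) x.
Proof.
move=> hp xp; case/splitPr: xp hp => p1 p2; rewrite -cat_rcons.
case/and3P; rewrite cat_path -cat_cons cat_uniq => /andP[hp _] /and3P[hu _ _] _.
by exists p1, p2; rewrite /simple_path hp hu last_rcons eqxx.
Qed.

(** Two simple paths that leave v in different directions do not meet: by
    uniqueness they would agree up to a common vertex. *)
Lemma simple_path_join v s p q w z :
  simple_path v (s :: p) w -> simple_path v q z -> ohead q <> Some s ->
  simple_path w (rev (belast v (s :: p)) ++ q) z.
Proof.
move=> hp hq hs; have := hp; have := hq.
move=> /and3P[q1 q2 /eqP q3] /and3P[p1 p2 /eqP p3].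
have disj x : x \in q -> x \notin s :: p.
  move=> xq; apply/negP => xp.
  have [pa [pb [pE hpa]]] := simple_path_through hp xp.
  have [qa [qb [qE hqa]]] := simple_path_through hq xq.
  by apply: hs; rewrite qE (simple_path_unique hqa hpa); case: (pa) pE => [[]|? ? []] ->.
have last_v : last w (rev (belast v (s :: p))) = v by rewrite /= rev_cons last_rcons.
apply/and3P; split; last by rewrite last_cat last_v q3.
- rewrite cat_path last_v q1 andbT -p3 rev_path.
  by rewrite (eq_path (e' := node)) // => x y; rewrite node_sym.
- rewrite -cat_cons -p3 -rev_rcons -lastI cat_uniq rev_uniq p2.
  move: q2; rewrite cons_uniq => /andP[vq ->]; rewrite andbT; apply/hasPn => x xq.
  rewrite mem_rev inE negb_or disj // andbT.
  by apply: contraNneq vq => <-.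
Qed.

End Trees.

Section PointedTrees.
Variable K : fieldType.
Variable G : stable_curve K 6.

Lemma towardP (v : component G) i q : simple_path v q (mark G i) ->
  toward v i (if q is s :: _ then inl s else inr i).
Proof.
case: q => [|s q] /and3P[h1 h2 /eqP h3]; first by split.
by exists q; split.
Qed.

Lemma toward_path (v : component G) i s : toward v i s -> exists q,
  simple_path v q (mark G i) /\ s = if q is s' :: _ then inl s' else inr i.
Proof.
case: s => [w [p [h1 h2 h3]]|j [-> h]].
  by exists (w :: p); split=> //; apply/and3P; split=> //; apply/eqP.
by exists [::]; split=> //; rewrite /simple_path /= -h eqxx.
Qed.

Lemma toward_unique (v : component G) i s s' : toward v i s -> toward v i s' -> s = s'.
Proof.
move=> /toward_path[q [hq ->]] /toward_path[q' [hq' ->]].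
by rewrite (simple_path_unique hq hq').
Qed.

(** A marked point that is not seen from v through the first edge towards w is
    reached from w by passing through v. *)
Lemma toward_apart (v w : component G) : v != w ->
  exists s t, forall i, toward v i s \/ toward w i t.
Proof.
move=> vw; have [[|s p] hp] := simple_path_exists v w.
  by case/and3P: hp vw => _ _ /eqP /= ->; rewrite eqxx.
case E: (rev (belast v (s :: p))) => [|t r].
  by have := size_rev (belast v (s :: p)); rewrite E.
exists (inl s), (inl t) => i.
have [q hq] := simple_path_exists v (mark G i).
have [hs|/eqP hs] := eqVneq (ohead q) (Some s).
  by left; have := towardP hq; case: q hq hs => //= ? ? _ [->].
by right; have := towardP (simple_path_join hp hq hs); rewrite E.
Qed.

(** When v and w are distinct, X is the node of v leading to w and Y the node of
    w leading to v; no marked point avoids both. *)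
Lemma images_apart (v w : component G) x y : images v x -> images w y ->
  x =1 y \/ exists X Y, forall i, x i = X \/ y i = Y.
Proof.
move=> hx hy; have [vw|vw] := eqVneq v w.
  left=> i; have [s hs ->] := hx i; have [t ht ->] := hy i.
  by rewrite -vw in ht *; rewrite (toward_unique hs ht).
right; have [s [t h]] := toward_apart vw; exists (pt v s), (pt w t) => i.
have [s' hs' ->] := hx i; have [t' ht' ->] := hy i.
by case: (h i) => [/(toward_unique hs')->|/(toward_unique ht')->]; [left|right].
Qed.

(** The pairs (k, l) = (3, 4), (2, 4), (2, 3) give f_1 to f_3, f_4 and f_5. *)
Lemma kapranov_form k l (z : 'rV[K]_k) (z' : 'rV[K]_l) :
  kapranov G z -> kapranov G z' -> (k < l)%N -> (l < 5)%N ->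
  forall i j : 'I_k, forall i' j' m : 'I_l,
  i' = i :> nat -> j' = j :> nat -> m = k :> nat ->
  generator_form (z 0 i) (z 0 j) (z' 0 i') (z' 0 j') (z' 0 m) = 0.
Proof.
move=> [v [x [a [[hx _ nx] _ hz]]]] [w [y [b [[hy _ ny] _ hz']]]] kl l5.
move=> i j i' j' m ei ej em; rewrite !hz !hz' ei ej em.
have lt_i := ltn_ord i; have lt_j := ltn_ord j.
have bx t : (t <= k)%N -> br (x (inord k.+1)) (x (inord t)) != 0.
  by move=> tk; apply: nx; rewrite inordK; lia.
have by_ t : (t <= l)%N -> br (y (inord l.+1)) (y (inord t)) != 0.
  by move=> tk; apply: ny; rewrite inordK; lia.
have i0 : ord0 = inord 0 :> 'I_6 by apply/val_inj; rewrite /= inordK.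
suff h : generator_form
    (br (x ord0) (x (inord i.+1)) / br (x (inord k.+1)) (x (inord i.+1)))
    (br (x ord0) (x (inord j.+1)) / br (x (inord k.+1)) (x (inord j.+1)))
    (br (y ord0) (y (inord i.+1)) / br (y (inord l.+1)) (y (inord i.+1)))
    (br (y ord0) (y (inord j.+1)) / br (y (inord l.+1)) (y (inord j.+1)))
    (br (y ord0) (y (inord k.+1)) / br (y (inord l.+1)) (y (inord k.+1))) = 0.
  by rewrite -[RHS](mulr0 (a * b * b)) -h /generator_form; ring.
have [xy|[X [Y h]]] := images_apart hx hy.
  rewrite -!xy; have b2 t : (t <= l)%N -> br (x (inord l.+1)) (x (inord t)) != 0.
    by rewrite !xy; apply: by_.
  by apply: generator_form_same; [apply: bx | apply: bx | apply: b2 ..]; lia.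
by apply: (generator_form_apart _ (h ord0) (h (inord i.+1)) (h (inord j.+1))
  (h (inord k.+1))); rewrite ?i0; apply: bx; lia.
Qed.

End PointedTrees.

(** * Smooth curves and saturation *)
Section Image.
Variable K : numFieldType.
Local Notation S := {mpoly K[2 + (3 + 4)]}.

Lemma J6_vanish (p : S) a b c :
  J6 p -> phi_image a b c -> p.@[coords a b c] = 0.
Proof.
move=> [n [r [g [hg ->]]]] [G [ha hb hc]].
rewrite raddf_sum big1 // => i _ /=; rewrite mevalM.
suff -> : (g i).@[coords a b c] = 0 by rewrite mulr0.
have ev := (mevalD, mevalN, mevalM, meval_var).
have := hg i; rewrite !inE => /or4P[|||/orP[]] /eqP->;
  rewrite ?/f1 ?/f2 ?/f3 ?/f4 ?/f5 !ev.
- by move: (kapranov_form hb hc); rewrite /generator_form; apply; rewrite ?inordK.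
- by move: (kapranov_form hb hc); rewrite /generator_form; apply; rewrite ?inordK.
- by move: (kapranov_form hb hc); rewrite /generator_form; apply; rewrite ?inordK.
- by move: (kapranov_form ha hc); rewrite /generator_form; apply; rewrite ?inordK.
- by move: (kapranov_form ha hb); rewrite /generator_form; apply; rewrite ?inordK.
Qed.

Section SmoothCurve.
Variable y : nat -> K.
Hypothesis hy : distinct_upto 5 y.

(** The point p_1 is at infinity and p_(i+2) is the point y_i. *)
Definition smooth_point (i : 'I_6) : 'rV[K]_2 :=
  if i == ord0 then \row_j (j == ord0)%:R
  else \row_j (if j == ord0 then y i.-1 else 1).

Lemma br_infty (j : 'I_6) : j != ord0 -> br (smooth_point ord0) (smooth_point j) = 1.
Proof.
by move=> j0; rewrite /br /smooth_point eqxx (negPf j0) !mxE /= mulr1 mul0r subr0.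
Qed.

Lemma br_finite (i j : 'I_6) : i != ord0 -> j != ord0 ->
  br (smooth_point i) (smooth_point j) = y i.-1 - y j.-1.
Proof.
move=> i0 j0; rewrite /br /smooth_point (negPf i0) (negPf j0) !mxE /=.
by rewrite mulr1 mul1r.
Qed.

Lemma smooth_point_distinct (i j : 'I_6) : i != j ->
  br (smooth_point i) (smooth_point j) != 0.
Proof.
wlog lt_ij : i j / (i < j)%N.
  move=> H ij; case: (ltngtP i j) => [h|h|/val_inj h]; first exact: H.
    by rewrite br_sym0 H // eq_sym.
  by rewrite h eqxx in ij.
move=> _; have j0 : j != ord0 by apply: contraTneq lt_ij => ->.
have [->|i0] := eqVneq i ord0; first by rewrite br_infty // oner_neq0.
rewrite br_finite // -oppr_eq0 opprB; apply: hy.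
by have := ltn_ord j; move: i0 j0; rewrite -!val_eqE /=; lia.
Qed.

Definition smooth_pt (v : unit) (s : unit + 'I_6) : 'rV[K]_2 :=
  if s is inr i then smooth_point i else 0.

Lemma smooth_tree (v w : unit) : exists! p : seq unit,
  [&& path (fun _ _ => false) v p, uniq (v :: p) & last v p == w].
Proof. by case: v w => [] []; exists [::]; split=> // -[|? ?]. Qed.

Lemma smooth_distinct (v : unit) (s t : unit + 'I_6) :
  special (fun _ _ => false) (fun _ : 'I_6 => tt) v s ->
  special (fun _ _ => false) (fun _ : 'I_6 => tt) v t ->
  s != t -> br (smooth_pt v s) (smooth_pt v t) != 0.
Proof. by case: s t => [//|i] [//|j] _ _ ij; apply: smooth_point_distinct. Qed.

Lemma smooth_stable (v : unit) : (2 < #|[pred s : unit + 'I_6 |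
  special (fun _ _ => false) (fun _ : 'I_6 => tt) v s]|)%N.
Proof.
apply/card_gt2P; exists (inr (inord 0)), (inr (inord 1)), (inr (inord 2)).
by case: v; split; split=> //; rewrite (inj_eq inr_inj) -val_eqE /= !inordK.
Qed.

Definition smooth_curve : stable_curve K 6 :=
  @StableCurve K 6 unit (fun _ _ => false) (fun _ => tt) smooth_pt
    (fun _ _ => erefl) (fun _ => erefl) smooth_tree smooth_distinct smooth_stable.

Lemma kapranov_smooth k : (0 < k < 5)%N -> kapranov smooth_curve (smooth_row k y).
Proof.
move=> k5; exists tt, smooth_point, 1; split; last 1 first.
- move=> j; have lj := ltn_ord j.
  have n0 m : (m < 5)%N -> inord m.+1 != ord0 :> 'I_6.
    by move=> m5; rewrite -val_eqE /= inordK.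
  rewrite br_infty ?br_finite ?n0 //; try lia.
  by rewrite !inordK ?mxE ?mul1r //; lia.
- split; first by move=> i; exists (inr i).
    exists (inord 0), (inord 1), (inord 2); rewrite !inordK //; split.
      by split=> //; lia.
    by split; apply: smooth_point_distinct; rewrite -val_eqE /= !inordK.
  move=> i ik; apply: smooth_point_distinct; rewrite -val_eqE /= inordK; lia.
- exact: oner_neq0.
Qed.

Lemma phi_image_smooth :
  phi_image (smooth_row 2 y) (smooth_row 3 y) (smooth_row 4 y).
Proof. by exists smooth_curve; split; apply: kapranov_smooth. Qed.
End SmoothCurve.

End Image.

Section Ideals.
Variable T : comNzRingType.

Lemma ideal_genD (H : T -> Prop) p q :
  ideal_gen H p -> ideal_gen H q -> ideal_gen H (p + q).
Proof.
move=> [n [r [g [hg ->]]]] [n' [r' [g' [hg' ->]]]].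
exists (n + n')%N.
exists (fun i => match split i with inl j => r j | inr j => r' j end).
exists (fun i => match split i with inl j => g j | inr j => g' j end).
split=> [i|]; first by case: split.
rewrite big_split_ord; congr (_ + _); apply: eq_bigr => i _.
  by rewrite (unsplitK (inl i)).
by rewrite (unsplitK (inr i)).
Qed.

Lemma ideal_genM (H : T -> Prop) r p : ideal_gen H p -> ideal_gen H (r * p).
Proof.
move=> [n [s [g [hg ->]]]]; exists n, (fun i => r * s i), g; split=> //.
by rewrite mulr_sumr; apply: eq_bigr => i _; rewrite mulrA.
Qed.

Lemma ideal_gen0 (H : T -> Prop) : ideal_gen H 0.
Proof.
by exists 0, (fun => 0), (fun => 0); split=> [[]//|]; rewrite big_ord0.
Qed.

Lemma ideal_gen_sub (H : T -> Prop) p : H p -> ideal_gen H p.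
Proof.
by move=> hp; exists 1, (fun => 1), (fun => p); split; rewrite ?big_ord1 ?mul1r.
Qed.

Lemma ideal_gen_is_ideal (H : T -> Prop) : is_ideal (ideal_gen H).
Proof.
by split; [exact: ideal_gen0 | exact: ideal_genD | move=> *; exact: ideal_genM].
Qed.

Lemma ideal_sum (I : T -> Prop) n (F : 'I_n -> T) :
  is_ideal I -> (forall i, I (F i)) -> I (\sum_(i < n) F i).
Proof. by case=> I0 ID _ hF; elim/big_ind: _. Qed.

Lemma ideal_gen_min (H I : T -> Prop) p : is_ideal I ->
  (forall q, H q -> I q) -> ideal_gen H p -> I p.
Proof.
move=> hI hHI [n [r [g [hg ->]]]]; apply: ideal_sum => // i.
by case: hI => _ _; apply; apply: hHI.
Qed.

Lemma ideal_gen_mull (H I : T -> Prop) p x : is_ideal I ->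
  (forall q, H q -> I (q * x)) -> ideal_gen H p -> I (p * x).
Proof.
move=> hI hHI; apply: (@ideal_gen_min H (fun p => I (p * x))) => //; case: hI => I0 ID IM.
by split=> [|u v hu hv|r u hu]; rewrite ?mul0r ?mulrDl -?mulrA; auto.
Qed.

End Ideals.

Section Saturation.
Variable K : fieldType.
Local Notation S := {mpoly K[2 + (3 + 4)]}.
Variable I : S -> Prop.
Hypotheses (hI : is_ideal I) (sat : saturated I).

Definition chart_elt (t : 'I_2 * 'I_3 * 'I_4) : S :=
  avar K 0 t.1.1 * bvar K 0 t.1.2 * cvar K 0 t.2.

(** The irrelevant ideal is contained in the three coordinate ideals, so a
    product of three of its elements is a combination of the a_i b_j c_k. *)
Lemma saturated_step p : (forall t, I (chart_elt t * p)) -> I p.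
Proof.
move=> h; apply: sat; exists 3 => g hg.
rewrite !big_ord_recr big_ord0 /= mul1r -!mulrA.
have [ga _ _] := hg (widen_ord (leqnSn 2) (widen_ord (leqnSn 1) ord_max)).
have [_ gb _] := hg (widen_ord (leqnSn 2) ord_max).
have [_ _ gc] := hg ord_max.
apply: (ideal_gen_mull hI _ ga) => _ [i ->]; rewrite mulrCA.
apply: (ideal_gen_mull hI _ gb) => _ [j ->]; rewrite mulrA mulrCA.
apply: (ideal_gen_mull hI _ gc) => _ [k ->].
by have := h (i, j, k); rewrite /chart_elt /=; congr I; ring.
Qed.

(** By downward induction on the exponents of a product of powers of the
    a_i b_j c_k: multiplying p by one more of them leads into I, and saturation
    removes one factor. *)
Lemma saturated_charts p :
  (forall t, exists N, I (chart_elt t ^+ N * p)) -> I p.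
Proof.
have [I0 ID IM] := hI; move=> /fin_all_exists[N hN].
suff H n (k : 'I_2 * 'I_3 * 'I_4 -> nat) :
    (\sum_t (N t - k t) <= n)%N -> I ((\prod_t chart_elt t ^+ k t) * p).
  by have := H _ (fun=> 0%N) (leqnn _); rewrite big1 ?mul1r // => t _; rewrite expr0.
have large_exponent t k0 : (N t <= k0 t)%N -> I ((\prod_s chart_elt s ^+ k0 s) * p).
  move=> le0; rewrite (bigD1 t) //= -(subnK le0) exprD.
  rewrite (_ : _ * p = (chart_elt t ^+ (k0 t - N t) *
    \prod_(s | s != t) chart_elt s ^+ k0 s) * (chart_elt t ^+ N t * p)); last ring.
  exact: IM.
elim: n k => [|n IH] k hk.
  pose t0 : 'I_2 * 'I_3 * 'I_4 := (ord0, ord0, ord0).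
  by apply: (large_exponent t0); move: hk; rewrite (bigD1 t0) //=; lia.
have [/existsP[t ht]|/existsPn no] := boolP [exists t, (N t <= k t)%N].
  exact: large_exponent ht.
apply: saturated_step => t.
have -> : chart_elt t * ((\prod_s chart_elt s ^+ k s) * p) =
    (\prod_s chart_elt s ^+ (k s + (s == t))) * p.
  rewrite mulrA; congr (_ * _); rewrite [in LHS](bigD1 t) //= [RHS](bigD1 t) //=.
  rewrite eqxx addn1 exprS mulrA; congr (_ * _); apply: eq_bigr => s /negPf->.
  by rewrite addn0.
apply: IH; move: hk (no t); rewrite -ltnNge (bigD1 t) //= => hk lt0.
rewrite (bigD1 t) //= eqxx addn1 (eq_bigr (fun s => N s - k s)%N).
  by move: (\sum_(_ | _) _)%N hk; lia.
by move=> s /negPf->; rewrite addn0.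
Qed.

End Saturation.

(** * The ideal of the image in the Cox ring *)
Section Core.
Variable K : numFieldType.
Local Notation S := {mpoly K[2 + (3 + 4)]}.

Lemma vanishing_of_phi (q : S) :
  (forall a b c, phi_image a b c -> q.@[coords a b c] = 0) -> vanishing q.
Proof. by move=> h y hy; apply/h/phi_image_smooth. Qed.

(** The key result: a form of multidegree (d,d,d) vanishing on smooth curves is
    generated by J_6 in multidegree (2,2,2).  The straightening argument is run
    on the subspace of Z of vanishing polynomials. *)
Lemma vanishing_generated (Z : S -> Prop) d q :
  Z 0 -> (forall p r, Z p -> Z r -> Z (p + r)) ->
  (forall x p, Z p -> Z (x *: p)) ->
  (forall k e g, mdegs k k k e -> J6_222 g -> Z (mon K e * g)) ->
  multihomog d d d q -> vanishing q -> Z q.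
Proof.
move=> Z0 ZD ZZ Zgen hq hv.
pose Z' p := Z p /\ vanishing p.
pose L := (\max_(m <- msupp q) level d (expo_of m)).+1.
suff [] : Z' q by [].
apply: (@below_Z _ Z' _ _ _ _ d (@vanishing K) _ _ _ L) => //.
- by split=> // y _; rewrite meval0.
- move=> p r [hp vp] [hr vr]; split; first exact: ZD.
  by move=> y hy; rewrite mevalD vp // vr // addr0.
- move=> x p [hp vp]; split; first exact: ZZ.
  by move=> y hy; rewrite mevalZ vp // mulr0.
- move=> k e g he hg; split; first exact: (Zgen _ _ _ he hg).
  apply: vanishing_of_phi => a b c habc; rewrite mevalM.
  by case: hg => /J6_vanish/(_ habc)-> _; rewrite mulr0.
- by move=> p r vp vr y hy; rewrite mevalB vp // vr // subr0.
- by move=> p [].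
- exact: top_coef_sum0.
- move=> m mq; split; first exact: (proj1 (multihomogE _ _ _ _) hq).
  by rewrite ltnS; rewrite (bigD1_seq m) ?msupp_uniq //= leq_max leqnn.
Qed.

Variable I : S -> Prop.
Hypothesis hI : is_I6 I.

Lemma I6_vanishing da db dc p : multihomog da db dc p -> I p -> vanishing p.
Proof.
case: hI => _ _ _ hX hp Ip y hy.
have [_ h] := hX ord0 ord0 ord0 da db dc p hp.
apply: h (phi_image_smooth hy) _; first by exists 0; rewrite expr0 mul1r.
by rewrite !mxE !mulf_neq0 ?invr_eq0 ?hy.
Qed.

Lemma I6_of_vanish da db dc p : multihomog da db dc p ->
  (forall a b c, phi_image a b c -> p.@[coords a b c] = 0) -> I p.
Proof.
case: hI => idI _ satI hX hp hv; apply: (saturated_charts idI satI) => -[[i j] k].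
by apply: (proj1 (hX i j k da db dc p hp)) => a b c /hv.
Qed.

Lemma diagonal_I6 p :
  diagonal_ideal I p <-> ideal_gen (@J6_222 K) p.
Proof.
split; apply: ideal_gen_min; first exact: ideal_gen_is_ideal.
- move=> q [Iq [d hq]]; have := I6_vanishing hq Iq.
  apply: vanishing_generated hq; first exact: ideal_gen0.
  + exact: ideal_genD.
  + by move=> x r; rewrite -mul_mpolyC; apply: ideal_genM.
  + by move=> k e g _ hg; apply/ideal_genM/ideal_gen_sub.
- exact: ideal_gen_is_ideal.
- move=> q [Jq hq]; apply: ideal_gen_sub; split; last by exists 2.
  by apply: I6_of_vanish hq _ => a b c; apply: J6_vanish.
Qed.

End Core.

(** * The Segre embedding *)
Section Segre.
Variable K : numFieldType.
Local Notation S := {mpoly K[2 + (3 + 4)]}.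
Local Notation P := {mpoly K[2 * (3 * 4)]}.
Local Notation index3 := ('I_2 * 'I_3 * 'I_4)%type.

Lemma segreE (T : comNzRingType) (a : 'rV[T]_2) b c i j k :
  segre a b c 0 (mxvec_index i (mxvec_index j k)) = a 0 i * b 0 j * c 0 k.
Proof. by rewrite /segre mxvecE !mxE big_ord1 mxvecE !mxE big_ord1 !mxE mulrA. Qed.

Lemma segre_map_tvar i j k :
  segre_map (tvar K i j k) = avar K 0 i * bvar K 0 j * cvar K 0 k.
Proof. by rewrite /segre_map comp_mpolyXU -tnth_nth tnth_mktuple segreE. Qed.

Lemma meval_segre_map (q : P) a b c :
  (segre_map q).@[coords a b c] = q.@[segre a b c 0].
Proof.
rewrite /segre_map comp_mpoly_meval; apply: meval_eq => l; rewrite tnth_mktuple.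
case/mxvec_indexP: l => i jk; case/mxvec_indexP: jk => j k.
by rewrite !segreE !mevalM !meval_var.
Qed.

(** Monomials in the t_ijk are handled as words in the index triples, which the
    Segre relations rearrange. *)
Definition word_mon (w : seq index3) : P := \prod_(t <- w) tvar K t.1.1 t.1.2 t.2.

Definition word_expo (w : seq index3) : 'X_{1..2 + (3 + 4)} :=
  (\sum_(t <- w) (U_(lshift (3 + 4) t.1.1) + U_(rshift 2 (lshift 4 t.1.2))
                  + U_(rshift 2 (rshift 3 t.2))))%MM.

Lemma segre_map_word w : segre_map (word_mon w) = 'X_[word_expo w].
Proof.
rewrite /word_mon /word_expo /segre_map rmorph_prod /= -mprodXE.
apply: eq_bigr => t _; have := segre_map_tvar t.1.1 t.1.2 t.2.
by rewrite /segre_map => ->; rewrite !mxE !mpolyXD.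
Qed.

Lemma word_of_mon (m : 'X_{1..2 * (3 * 4)}) :
  exists2 w, 'X_[m] = word_mon w & size w = mdeg m.
Proof.
have [n] := ubnP (mdeg m); elim: n m => // n IH m; rewrite ltnS => hm.
have [->|/eqP m0] := eqVneq m 0%MM.
  by exists [::]; rewrite ?mdeg0 // /word_mon big_nil mpolyX0.
have [l hl] : exists l, m l != 0%N.
  apply/existsP; apply: contra_notT m0 => /existsPn h; apply/mnmP => l.
  by rewrite mnm0E; apply/eqP; have := h l; rewrite negbK.
have le1 : (U_(l) <= m)%MM by rewrite lep1mP.
have em : mdeg m = (mdeg (m - U_(l))%MM).+1.
  by rewrite -{1}(submK le1) mdegD mdeg1 addn1.
have [|w wE ws] := IH (m - U_(l))%MM; first by lia.
case/mxvec_indexP: l hl le1 em w wE ws => i jk; case/mxvec_indexP: jk => j k.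
move=> _ le1 -> w wE <-; exists ((i, j, k) :: w) => //.
by rewrite -(submK le1) addmC mpolyXD wE /word_mon big_cons.
Qed.

Lemma word_expo_a w i : word_expo w (lshift (3 + 4) i) =
  count (fun t => t.1.1 == i) w.
Proof.
rewrite /word_expo; elim: w => [|t w IH]; first by rewrite big_nil mnm0E.
rewrite big_cons !mnmDE !mnm1E IH eq_lshift !eq_rlshift.
by rewrite /= !addn0.
Qed.

Lemma word_expo_b w j : word_expo w (rshift 2 (lshift 4 j)) =
  count (fun t => t.1.2 == j) w.
Proof.
rewrite /word_expo; elim: w => [|t w IH]; first by rewrite big_nil mnm0E.
rewrite big_cons !mnmDE !mnm1E IH eq_lrshift !eq_rshift eq_lshift eq_rlshift.
by rewrite /= !addn0.
Qed.

Lemma word_expo_c w k : word_expo w (rshift 2 (rshift 3 k)) =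
  count (fun t => t.2 == k) w.
Proof.
rewrite /word_expo; elim: w => [|t w IH]; first by rewrite big_nil mnm0E.
rewrite big_cons !mnmDE !mnm1E IH eq_lrshift !eq_rshift eq_lrshift.
by [].
Qed.

Lemma word_mdegs w : mdegs (size w) (size w) (size w) (expo_of (word_expo w)).
Proof.
have cnt n (f : index3 -> 'I_n.+1) : (\sum_(i < n.+1) count (fun t => f t == i) w)%N = size w.
  elim: w => [|t w IH] /=; first by rewrite big1.
  rewrite big_split /= IH (bigD1 (f t)) //= eqxx big1 ?addn0 // => i ne.
  by rewrite eq_sym (negPf ne).
have h : multihomog (size w) (size w) (size w) ('X_[word_expo w] : S).
  move=> m; rewrite msuppX inE => /eqP->; split.
  - by rewrite -(cnt _ (fun t => t.1.1)); apply: eq_bigr => i _; rewrite word_expo_a.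
  - by rewrite -(cnt _ (fun t => t.1.2)); apply: eq_bigr => i _; rewrite word_expo_b.
  - by rewrite -(cnt _ (fun t => t.2)); apply: eq_bigr => i _; rewrite word_expo_c.
by apply: (proj1 (multihomogE _ _ _ _) h); rewrite msuppX mem_head.
Qed.

End Segre.

Section SegreKernel.
Variable K : numFieldType.
Local Notation S := {mpoly K[2 + (3 + 4)]}.
Local Notation P := {mpoly K[2 * (3 * 4)]}.
Local Notation index3 := ('I_2 * 'I_3 * 'I_4)%type.
Local Notation mon3 := (@word_mon K).

Definition segre_cong (p q : P) := ideal_gen (@segre_relation K) (p - q).

Lemma segre_cong_refl p : segre_cong p p.
Proof. by rewrite /segre_cong subrr; apply: ideal_gen0. Qed.

Lemma segre_cong_sym p q : segre_cong p q -> segre_cong q p.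
Proof. by move=> h; rewrite /segre_cong -opprB -mulN1r; apply: ideal_genM. Qed.

Lemma segre_cong_trans q p r :
  segre_cong p q -> segre_cong q r -> segre_cong p r.
Proof. by move=> h /(ideal_genD h); rewrite addrA subrK. Qed.

Lemma segre_congM r p q : segre_cong p q -> segre_cong (r * p) (r * q).
Proof. by rewrite /segre_cong -mulrBr; apply: ideal_genM. Qed.

Lemma word_mon_perm w w' : perm_eq w w' -> mon3 w = mon3 w'.
Proof. exact: perm_big. Qed.

Lemma word_mon_cons t w : mon3 (t :: w) = tvar K t.1.1 t.1.2 t.2 * mon3 w.
Proof. exact: big_cons. Qed.

Lemma segre_cong_pair t u t' u' (w : seq index3) :
  segre_relation (tvar K t.1.1 t.1.2 t.2 * tvar K u.1.1 u.1.2 u.2 -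
    tvar K t'.1.1 t'.1.2 t'.2 * tvar K u'.1.1 u'.1.2 u'.2) ->
  segre_cong (mon3 [:: t, u & w]) (mon3 [:: t', u' & w]).
Proof.
move=> h; rewrite !word_mon_cons !mulrA ![_ * mon3 w]mulrC.
exact/segre_congM/ideal_gen_sub.
Qed.

(** Equivalently, the two words have the same image under the Segre map. *)
Definition same_marginals (w w' : seq index3) :=
  [/\ forall i, count (fun t => t.1.1 == i) w = count (fun t => t.1.1 == i) w',
      forall j, count (fun t => t.1.2 == j) w = count (fun t => t.1.2 == j) w'
    & forall k, count (fun t => t.2 == k) w = count (fun t => t.2 == k) w'].

Lemma perm_marginals w w' : perm_eq w w' -> same_marginals w w'.
Proof. by move=> /permP h; split=> ?; apply: h. Qed.

Lemma same_marginals_trans w' w w'' :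
  same_marginals w w' -> same_marginals w' w'' -> same_marginals w w''.
Proof.
move=> [a1 b1 c1] [a2 b2 c2].
by split=> ?; rewrite ?a1 ?a2 ?b1 ?b2 ?c1 ?c2.
Qed.

Lemma pick_from_word (a : pred index3) w : (0 < count a w)%N ->
  exists t w', a t /\ perm_eq w (t :: w').
Proof.
rewrite -has_count => /hasP[t tw at_]; exists t, (rem t w); split=> //.
exact: perm_to_rem.
Qed.

(** A triple whose three entries occur in w, possibly in different letters, can
    be assembled at the front by two exchanges. *)
Lemma word_front i j k w : (0 < count (fun t => t.1.1 == i) w)%N ->
  (0 < count (fun t => t.1.2 == j) w)%N -> (0 < count (fun t => t.2 == k) w)%N ->
  exists w', segre_cong (mon3 w) (mon3 ((i, j, k) :: w')) /\
    same_marginals w ((i, j, k) :: w').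
Proof.
move=> hi hj hk.
have [[[i0 j0] k0] [w1 [/= /eqP -> p1]]] := pick_from_word hi.
have [_ m1b m1c] := perm_marginals p1.
have [w2 [c2 m2]] : exists w2, segre_cong (mon3 w) (mon3 ((i, j, k0) :: w2)) /\
    same_marginals w ((i, j, k0) :: w2).
  have [e|nj] := eqVneq j0 j.
    exists w1; rewrite -e (word_mon_perm p1); split; first exact: segre_cong_refl.
    exact: perm_marginals.
  have := hj; rewrite m1b /= (negPf nj) => /pick_from_word.
  case=> -[[i1 j1] k1] [w2 [/= /eqP -> p2]].
  have p12 : perm_eq w [:: (i, j0, k0), (i1, j, k1) & w2].
    by apply: perm_trans p1 _; rewrite perm_cons.
  exists ((i1, j0, k1) :: w2); split.
    rewrite (word_mon_perm p12); apply: segre_cong_pair.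
    by exists i, i1, j0, j, k0, k1; apply: Or32.
  apply: same_marginals_trans (perm_marginals p12) _.
  by split=> ? /=; lia.
have [e|nk] := eqVneq k0 k; first by exists w2; rewrite -e.
have [_ _ m2c] := m2.
have := hk; rewrite m2c /= (negPf nk) => /pick_from_word.
case=> -[[i1 j1] k1] [w3 [/= /eqP -> p3]].
have p23 : perm_eq ((i, j, k0) :: w2) [:: (i, j, k0), (i1, j1, k) & w3].
  by rewrite perm_cons.
exists ((i1, j1, k0) :: w3); split.
  apply: segre_cong_trans c2 _; rewrite (word_mon_perm p23).
  apply: segre_cong_pair.
  by exists i, i1, j, j1, k0, k; apply: Or33.
apply: same_marginals_trans m2 _.
apply: same_marginals_trans (perm_marginals p23) _.
by split=> ? /=; lia.
Qed.

Lemma marginals_cong w w' : same_marginals w w' -> segre_cong (mon3 w) (mon3 w').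
Proof.
elim: w w' => [|[[i j] k] w IH] w' [ha hb hc].
  case: w' ha {hb hc} => [|t w'] h; first exact: segre_cong_refl.
  by have := h t.1.1; rewrite /= eqxx.
have pos (a : pred index3) : a (i, j, k) -> (0 < count a ((i, j, k) :: w))%N.
  by move=> /= ->.
have [|||w1 [c1 [ha1 hb1 hc1]]] := @word_front i j k w'.
- by rewrite -ha pos //=.
- by rewrite -hb pos //=.
- by rewrite -hc pos //=.
apply: segre_cong_trans (segre_cong_sym c1); rewrite !word_mon_cons.
apply/segre_congM/IH; split=> x.
- by have := ha x; rewrite ha1 /=; lia.
- by have := hb x; rewrite hb1 /=; lia.
- by have := hc x; rewrite hc1 /=; lia.
Qed.

Definition segre_expo (m : 'X_{1..2 * (3 * 4)}) : 'X_{1..2 + (3 + 4)} :=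
  mlead (segre_map ('X_[m] : P)).

Lemma segre_mapX m : segre_map ('X_[m] : P) = 'X_[segre_expo m].
Proof.
by have [w e _] := word_of_mon K m; rewrite /segre_expo e segre_map_word mleadXm.
Qed.

Lemma segre_expo_mdegs m :
  mdegs (mdeg m) (mdeg m) (mdeg m) (expo_of (segre_expo m)).
Proof.
have [w e <-] := word_of_mon K m.
by rewrite /segre_expo e segre_map_word mleadXm; apply: word_mdegs.
Qed.

Lemma segre_fiber m m' : segre_expo m = segre_expo m' ->
  segre_cong 'X_[m] 'X_[m'].
Proof.
have [w e _] := word_of_mon K m; have [w' e' _] := word_of_mon K m'.
rewrite /segre_expo e e' !segre_map_word !mleadXm => h; apply: marginals_cong.
by split=> x; rewrite -?word_expo_a -?word_expo_b -?word_expo_c h.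
Qed.

Lemma segre_mapE (p : P) :
  segre_map p = \sum_(m <- msupp p) p@_m *: 'X_[segre_expo m].
Proof.
rewrite {1}(mpolyE p) /segre_map raddf_sum; apply: eq_bigr => m _.
by rewrite /= comp_mpolyZ -/(segre_map _) segre_mapX.
Qed.

(** Replace each monomial by a representative of its fiber; the coefficients
    collected on a representative form a coefficient of the image, which is 0. *)
Lemma segre_kernel (p : P) :
  segre_map p = 0 -> ideal_gen (@segre_relation K) p.
Proof.
move=> p0; pose r := msupp p.
(* The default value 0 is reached only for M outside the image of r. *)
pose rep M := head 0%MM [seq m <- r | segre_expo m == M].
have repP m : m \in r -> segre_expo (rep (segre_expo m)) = segre_expo m.
  move=> mr; rewrite /rep.
  have mM : m \in [seq m' <- r | segre_expo m' == segre_expo m].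
    by rewrite mem_filter eqxx.
  have /allP all_eq := filter_all (fun m' => segre_expo m' == segre_expo m) r.
  apply/eqP/all_eq; case: (filter _ _) mM => [|m' s _]; first by rewrite in_nil.
  exact: mem_head.
have sum0 : \sum_(m <- r) p@_m *: 'X_[rep (segre_expo m)] = 0 :> P.
  pose U := undup (map segre_expo r).
  transitivity (\sum_(M <- U) (segre_map p)@_M *: 'X_[rep M] : P); last first.
    by rewrite big1 // => M _; rewrite p0 mcoeff0 scale0r.
  under [RHS]eq_bigr => M _.
    rewrite segre_mapE raddf_sum /= scaler_suml.
    under eq_bigr => m _ do rewrite mcoeffZ mcoeffX.
    over.
  rewrite exchange_big /= big_seq [RHS]big_seq; apply: eq_bigr => m mr.
  have mU : segre_expo m \in U by rewrite mem_undup map_f.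
  rewrite (bigD1_seq _ mU (undup_uniq _)) /= eqxx mulr1 big1 ?addr0 // => M ne.
  by rewrite eq_sym (negPf ne) mulr0 scale0r.
have -> : p = \sum_(m <- r) (p@_m *: 'X_[m] - p@_m *: 'X_[rep (segre_expo m)]).
  by rewrite sumrB sum0 subr0 -mpolyE.
rewrite big_seq.
elim/big_ind: _ => [|u v|m mr]; first exact: ideal_gen0.
  exact: ideal_genD.
rewrite -scalerBr -mul_mpolyC; apply: ideal_genM; apply: segre_fiber.
by rewrite repP.
Qed.

Lemma segre_map_homog d (q : P) : q \is d.-homog -> multihomog d d d (segre_map q).
Proof.
move=> hq; rewrite segre_mapE big_seq; elim/big_ind: _ => [|u v|m mq].
- exact: multihomog0.
- exact: multihomogD.
apply: multihomogZ; rewrite -mon_expo_of; apply: multihomog_mon.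
by have := segre_expo_mdegs m; rewrite (dhomog_mf hq mq).
Qed.

Lemma word_exists k (m : 'X_{1..2 + (3 + 4)}) : mdegs k k k (expo_of m) ->
  exists2 w, size w = k & word_expo w = m.
Proof.
elim: k m => [|k IH] m hm.
  exists [::] => //; apply: expo_of_inj; move: hm; rewrite /word_expo big_nil.
  by rewrite /mdegs /expo_of /= !mnm0E => -[*]; congr Expo; lia.
have hM : multihomog k.+1 k.+1 k.+1 ('X_[m] : S).
  by rewrite -mon_expo_of; apply: multihomog_mon.
have pos n (f : 'I_n -> nat) : (\sum_(i < n) f i = k.+1)%N -> exists i, (0 < f i)%N.
  move=> e; apply/existsP; apply: contra_eqT e => /existsPn h.
  by rewrite big1 // => i _; have := h i; case: (f i).
have /hM[] : m \in msupp ('X_[m] : S) by rewrite msuppX mem_head.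
move=> /pos[i hi] /pos[j hj] /pos[l hl].
pose u : 'X_{1..2 + (3 + 4)} := word_expo [:: (i, j, l)].
have le_u : (u <= m)%MM.
  apply/mnm_lepP => x.
  case: (split_ordP x) => [x1 ->|x23 ->].
    by rewrite word_expo_a /= addn0; case: eqP => // <-.
  case: (split_ordP x23) => [x2 ->|x3 ->].
    by rewrite word_expo_b /= addn0; case: eqP => // <-.
  by rewrite word_expo_c /= addn0; case: eqP => // <-.
have [|w ws we] := IH (m - u)%MM.
  have := word_mdegs K [:: (i, j, l)]; move: hm; rewrite -{1}(submK le_u).
  by rewrite /mdegs /expo_of /= !mnmDE -/u => -[? ? ?] [? ? ?]; split; lia.
exists ((i, j, l) :: w); first by rewrite /= ws.
rewrite -(submK le_u) -we /u /word_expo !big_cons big_nil addm0.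
by rewrite addmC.
Qed.

Lemma tvar_homog i j l : tvar K i j l \is 1.-homog.
Proof. by rewrite /tvar dhomogX /= mdeg1. Qed.

Lemma segre_lift k (g : S) : multihomog k k k g ->
  exists2 q : P, q \is k.-homog & segre_map q = g.
Proof.
move=> /multihomogE hg.
suff H (r : seq 'X_{1..2 + (3 + 4)}) (u : _ -> K) :
    (forall m, m \in r -> mdegs k k k (expo_of m)) ->
    exists2 q : P, q \is k.-homog & segre_map q = \sum_(m <- r) u m *: 'X_[m].
  by have [q hq e] := H _ (fun m => g@_m) hg; exists q => //; rewrite e -mpolyE.
elim: r => [|m r IH] hr.
  by exists 0; rewrite ?dhomog0 // big_nil /segre_map comp_mpoly0.
have [|q hq e] := IH; first by move=> m' h; apply: hr; rewrite inE h orbT.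
have [w ws we] := word_exists (hr m (mem_head _ _)).
exists (u m *: mon3 w + q).
  rewrite dhomogD // dhomogZ // /word_mon -ws.
  elim: (w) => [|t w' IHw]; first by rewrite big_nil dhomog1.
  rewrite big_cons -[size _]/(1 + size w')%N dhomogM //.
  exact: tvar_homog.
by rewrite big_cons -e -we -segre_map_word /segre_map comp_mpolyD comp_mpolyZ.
Qed.

Lemma segre_relation_kappa (g : P) : segre_relation g ->
  g \is 2.-homog /\ segre_map g = 0.
Proof.
have hom i j k i' j' k' : tvar K i j k * tvar K i' j' k' \is 2.-homog.
  by rewrite -[2%N]/(1 + 1)%N dhomogM // tvar_homog.
have segM u v : segre_map (u * v) = segre_map u * segre_map v.
  exact: rmorphM.
move=> [i [i' [j [j' [k [k' h]]]]]].
by case: h => ->; (split; first by apply: rpredB; apply: hom);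
  rewrite /segre_map comp_mpolyB -!/(segre_map _) !segM !segre_map_tvar; ring.
Qed.

(** A form vanishing on the image is, by [vanishing_generated] applied to its
    image in the Cox ring, a combination of quadrics up to the Segre kernel. *)
Lemma kappa_ideal (q : P) :
  homog_ideal (@kappa_image K) q <->
  ideal_gen (fun g => J6_quadric g \/ segre_relation g) q.
Proof.
split; apply: ideal_gen_min; first exact: ideal_gen_is_ideal.
- move=> {}q [[d hq] hv].
  pose Z (p : S) := exists q', segre_map q' = p /\
    ideal_gen (fun g : P => J6_quadric g \/ segre_relation g) q'.
  have [||||||q' [e hq']] := @vanishing_generated K Z d (segre_map q).
  - by exists 0; split; [rewrite /segre_map comp_mpoly0 | exact: ideal_gen0].
  - move=> p r [u [<- hu]] [v [<- hv']]; exists (u + v).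
    by split; [rewrite /segre_map comp_mpolyD | exact: ideal_genD].
  - move=> x p [u [<- hu]]; exists (x *: u).
    by split; [rewrite /segre_map comp_mpolyZ | rewrite -mul_mpolyC; exact: ideal_genM].
  - move=> k e g he [Jg hg]; have [u _ <-] := segre_lift (@multihomog_mon K _ _ _ _ he).
    have [v hv' ev] := segre_lift hg; exists (u * v).
    split; first by rewrite /segre_map rmorphM /= -!/(segre_map _) ev.
    by apply/ideal_genM/ideal_gen_sub; left; split=> //; rewrite /J6_222 ev.
  - exact: segre_map_homog.
  - apply: vanishing_of_phi => a b c habc; rewrite meval_segre_map; apply: hv.
    by exists a, b, c.
  rewrite -[q](subrK q') addrC; apply: ideal_genD => //.
  have : ideal_gen (@segre_relation K) (q - q').
    by apply: segre_kernel; rewrite /segre_map rmorphB /= -!/(segre_map _) e subrr.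
  apply: ideal_gen_min; first exact: ideal_gen_is_ideal.
  by move=> g hg; apply: ideal_gen_sub; right.
- exact: ideal_gen_is_ideal.
- move=> g hg; apply: ideal_gen_sub.
  have [h2 hJ] : g \is 2.-homog /\ forall a b c, phi_image a b c ->
      (segre_map g).@[coords a b c] = 0.
    case: hg => [[h2 [hJ _]]|/segre_relation_kappa[h2 ->]]; split=> // a b c habc.
      exact: J6_vanish habc.
    by rewrite meval0.
  split; first by exists 2.
  by move=> _ [a [b [c [habc ->]]]]; rewrite -meval_segre_map hJ.
Qed.

End SegreKernel.

Theorem theorem1p5 (R : realType) (I6 : {mpoly R[i][2 + (3 + 4)]} -> Prop)
    (hI6 : is_I6 I6) :
  (forall p : {mpoly R[i][2 + (3 + 4)]},
     diagonal_ideal I6 p <-> ideal_gen (@J6_222 R[i]) p) /\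
  (forall q : {mpoly R[i][2 * (3 * 4)]},
     homog_ideal (@kappa_image R[i]) q <->
     ideal_gen (fun g => J6_quadric g \/ segre_relation g) q).
Proof.
split=> [p|q]; first exact: (@diagonal_I6 (R[i] : numFieldType) I6 hI6 p).
exact: (@kappa_ideal (R[i] : numFieldType) q).
Qed.
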